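(* Let $E$ and $F$ be Banach spaces over $\mathbb{K}$, and let $G$ be a Banach space over $\mathbb{K}$ with an unconditional basis $(g_{i})_{i\in\mathbb{N}}$ and coordinate functionals $(g'_{i})_{i\in\mathbb{N}}\subset G'$. (a) If there exist operators $R\in\mathcal{L}(G;F)$ and $S\in\mathcal{L}(E;G)$ such that $(R(g_{i}))_{i}$ is a seminormalized basic sequence in $F$ and the set $\{S'(g'_{i}): i\in\mathbb{N}\}$ is not relatively compact in $E'$, then $\mathcal{P}_{K}(^{n}E;F)$ is not complemented in $\mathcal{P}(^{n}E;F)$ for every $n\in\mathbb{N}$. (b) If there exist operators $R\in\mathcal{L}(G;F)$ and $S\in\mathcal{L}(E;G)$ such that $(R(g_{i}))_{i}$ is a seminormalized basic sequence in $F$ and the set $\{S'(g'_{i}): i\in\mathbb{N}\}$ is not relatively weakly compact in $E'$, then $\mathcal{P}_{wK}(^{n}E;F)$ is not complemented in $\mathcal{P}(^{n}E;F)$ for every $n\in\mathbb{N}$. (In both parts, non-complementation holds for each $n\in\mathbb{N}$.)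
   Context: $\mathbb{K}$ is $\mathbb{R}$ or $\mathbb{C}$. $E'$ is the dual of $E$, $\mathcal{L}(E;F)$ is the space of bounded linear operators from $E$ into $F$, and $S':G'\to E'$ is the adjoint of $S$. For $n\in\mathbb{N}=\{1,2,\dots\}$, $\mathcal{P}(^{n}E;F)$ is the Banach space of all continuous $n$-homogeneous polynomials from $E$ into $F$, with norm $\|P\|=\sup_{\|x\|\le 1}\|P(x)\|$. $\mathcal{P}_{K}(^{n}E;F)$ (resp. $\mathcal{P}_{wK}(^{n}E;F)$) is the subspace of all $P\in\mathcal{P}(^{n}E;F)$ which map bounded sets to relatively compact (resp. relatively weakly compact) sets. A sequence $(x_{i})$ in a Banach space is a seminormalized basic sequence if it is a Schauder basis of its closed linear span and there are constants $a,b$ with $0<a<\|x_{i}\|<b$ for all $i$. A subspace is complemented if it is the range of a bounded linear projection of the whole space. *)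

(* Defs.v *)
From HB Require Import structures.
From mathcomp Require Import all_boot all_order all_algebra.
From mathcomp Require Import complex.
From mathcomp Require Import all_classical all_reals all_analysis.

Set Implicit Arguments.
Unset Strict Implicit.
Unset Printing Implicit Defensive.

Import Order.TTheory GRing.Theory Num.Theory.
Import numFieldNormedType.Exports.

Local Open Scope classical_set_scope.
Local Open Scope ring_scope.

Variant scalar_kind := RealScalars | ComplexScalars.

Definition scalar_field (R : realType) (k : scalar_kind) : numFieldType :=
  match k with RealScalars => R | ComplexScalars => R[i] end.

Section scalar_sup.
Variables (R : realType) (k : scalar_kind).
Local Notation K := (scalar_field R k).

(* The order of [R[i]] is only partial, but nonnegative elements are real. *)
Lemma scalar_supremums (A : set K) (M : K) :
  A !=set0 -> (forall x, A x -> 0 <= x) -> ubound A M ->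
  exists s, supremums A s.
Proof.
case: k A M => /= A M [x0 Ax0] A0 AM.
  have hA : has_sup A by split; [exists x0 | exists M].
  exists (sup A); split; first exact: sup_upper_bound.
  by move=> y Ay; apply: ge_sup => //; exists x0.
pose B := [set r : R | A (r%:C)%C].
have AE x : A x -> x = ((complex.Re x)%:C)%C.
  by move=> /A0; case: x => a b; rewrite lecE /= => /andP[/eqP -> _].
have hB : has_sup B.
  split; first by exists (complex.Re x0); rewrite /B /= -AE.
  by exists (complex.Re M) => r /AM; rewrite lecE /= => /andP[].
exists ((sup B)%:C)%C; split.
  move=> x Ax; rewrite (AE _ Ax) lecR; apply: sup_upper_bound => //.
  by rewrite /B /= -AE.
move=> y Ay; have := Ay _ Ax0; rewrite {1}(AE _ Ax0) lecE /= => /andP[yi _].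
rewrite lecE /= yi /=; apply: ge_sup; first by case: hB.
by move=> r /Ay; rewrite lecE => /andP[].
Qed.

End scalar_sup.

Section sup_norm.
Variables (R : realType) (k : scalar_kind).
Local Notation K := (scalar_field R k).
Variables E F : normedModType K.
Implicit Types f g : E -> F.

(* MathComp norms take values in [K], so the supremum is taken in [K] too;
   [ball_supP] shows that it exists when [f] is bounded on the unit ball. *)
Definition ball_sup f : K :=
  supremum 0 [set `|f x| | x in [set x : E | `|x| <= 1]].

Definition ball_bounded f := exists M : K, forall x, `|x| <= 1 -> `|f x| <= M.

Lemma ball_supP f : ball_bounded f ->
  supremums [set `|f x| | x in [set x : E | `|x| <= 1]] (ball_sup f).
Proof.
move=> [M fM]; rewrite /ball_sup /supremum; case: ifPn => [/eqP A0|A0].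
  have : [set `|f x| | x in [set x : E | `|x| <= 1]] `|f 0|.
    by exists 0 => //=; rewrite normr0.
  by rewrite A0.
have [|_ [x x1 <-] //|_ [x x1 <-]|s sA] := @scalar_supremums R k
  [set `|f x| | x in [set x : E | `|x| <= 1]] M.
- exact/set0P.
- exact: fM.
- exact: xgetI sA.
Qed.

Lemma ball_sup_ge f x : ball_bounded f -> `|x| <= 1 -> `|f x| <= ball_sup f.
Proof. by move=> /ball_supP[fub _] x1; apply: fub; exists x. Qed.

Lemma ball_sup_le f M : ball_bounded f ->
  (forall x, `|x| <= 1 -> `|f x| <= M) -> ball_sup f <= M.
Proof. by move=> /ball_supP[_ flb] fM; apply: flb => _ [x x1 <-]; exact: fM. Qed.

Lemma ball_supD f g : ball_bounded f -> ball_bounded g ->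
  ball_sup (f \+ g) <= ball_sup f + ball_sup g.
Proof.
move=> bf bg; have le x : `|x| <= 1 -> `|(f \+ g) x| <= ball_sup f + ball_sup g.
  by move=> x1; rewrite (le_trans (ler_normD _ _)) ?lerD ?ball_sup_ge.
by apply: ball_sup_le => //; exists (ball_sup f + ball_sup g).
Qed.

Lemma ball_supZ (l : K) f : ball_bounded f ->
  ball_sup (l *: f) = `|l| * ball_sup f.
Proof.
move=> bf; have le x : `|x| <= 1 -> `|(l *: f) x| <= `|l| * ball_sup f.
  by move=> x1; rewrite normrZ ler_wpM2l ?ball_sup_ge.
have blf : ball_bounded (l *: f) by exists (`|l| * ball_sup f).
apply/eqP; rewrite eq_le ball_sup_le //=.
have [->|l0] := eqVneq l 0.
  rewrite normr0 mul0r (le_trans _ (@ball_sup_ge _ 0 _ _)) // ?normr0 //.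
  by rewrite scale0r; exists 0 => x _; rewrite normr0.
rewrite -ler_pdivlMl ?normr_gt0 //; apply: ball_sup_le => // x x1.
by rewrite ler_pdivlMl ?normr_gt0 // -normrZ; exact: (ball_sup_ge blf x1).
Qed.

Section homogeneous.
Variables (n : nat) (f : E -> F).
Hypothesis fh : forall (c : K) x, f (c *: x) = c ^+ n *: f x.

Lemma homogeneous_bounded : {for 0, continuous f} -> ball_bounded f.
Proof.
move=> f0; have := @cvgr_norm_lt _ _ _ _ _ _ _ f0 (`|f 0| + 1).
rewrite ltrDl ltr01 => /(_ _ isT) /nbhs_norm0P[/= e e0 fe].
pose c := e / 2; have c0 : 0 < c by rewrite divr_gt0.
exists (c ^- n * (`|f 0| + 1)) => x x1.
rewrite ler_pdivlMl ?exprn_gt0 //.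
rewrite -{1}(gtr0_norm (exprn_gt0 n c0)) -normrZ -fh ltW //; apply: fe => /=.
rewrite normrZ gtr0_norm // (le_lt_trans (ler_piMr (ltW c0) x1)) //.
by rewrite ltr_pdivrMr // ltr_pMr // ltr1n.
Qed.

Lemma homogeneous_eq0 : ball_bounded f -> ball_sup f = 0 -> f = 0.
Proof.
move=> bf f0; apply/funext => x.
have H y : `|y| <= 1 -> f y = 0.
  by move=> /(ball_sup_ge bf); rewrite f0 normr_le0 => /eqP.
have [->|x0] := eqVneq x 0; first by apply: H; rewrite normr0.
have -> : x = `|x| *: (`|x|^-1 *: x).
  by rewrite scalerA divff ?normr_eq0 // scale1r.
rewrite fh H ?scaler0 // normrZ normfV normr_id mulVf ?normr_eq0 //.
Qed.

End homogeneous.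
End sup_norm.

Section spaces.
Variables (R : realType) (k : scalar_kind).
Local Notation K := (scalar_field R k).

Section operators.
Variables E F : normedModType K.

Definition bounded_linear : {pred E -> F} :=
  fun f => `[< linear f /\ continuous f >].

Record blin := Blin { blin_fun :> E -> F ; blinP : blin_fun \in bounded_linear }.

HB.instance Definition _ := [isSub for blin_fun].
HB.instance Definition _ := [Choice of blin by <:].

Lemma blin_linear (f : blin) : linear f.
Proof. by have /asboolP[] := blinP f. Qed.

Lemma blin_continuous (f : blin) : continuous f.
Proof. by have /asboolP[] := blinP f. Qed.

HB.instance Definition _ (f : blin) :=
  GRing.isLinear.Build K E F *:%R f (blin_linear f).

Lemma bounded_linear_submod : submod_closed bounded_linear.
Proof.
split.
  apply/asboolP; split; last exact: cst_continuous.
  by move=> a x y; rewrite /= scaler0 addr0.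
move=> a f g /asboolP[lf cf] /asboolP[lg cg]; apply/asboolP; split.
  move=> b x y; rewrite /= !fctE lf lg !scalerDr !scalerA [b * a]mulrC.
  by rewrite addrACA.
by move=> x; apply: cvgD; [apply: cvgZr; exact: cf|exact: cg].
Qed.

HB.instance Definition _ :=
  GRing.isSubmodClosed.Build K (E -> F) bounded_linear bounded_linear_submod.
HB.instance Definition _ := [SubChoice_isSubLmodule of blin by <:].


Lemma blin_homogeneous (f : blin) (c : K) x : f (c *: x) = c ^+ 1 *: f x.
Proof. by rewrite expr1 linearZ. Qed.

Lemma blin_bounded (f : blin) : ball_bounded f.
Proof.
exact: homogeneous_bounded (blin_homogeneous f) (@blin_continuous f 0).
Qed.

Definition blin_norm (f : blin) : K := ball_sup f.

Let blin_normD f g : blin_norm (f + g) <= blin_norm f + blin_norm g.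
Proof. exact: ball_supD (blin_bounded f) (blin_bounded g). Qed.

Let blin_normZ (l : K) f : blin_norm (l *: f) = `|l| * blin_norm f.
Proof. exact: ball_supZ (blin_bounded f). Qed.

Let blin_norm_eq0 f : blin_norm f = 0 -> f = 0.
Proof.
move=> f0; apply/val_inj.
exact: homogeneous_eq0 (blin_homogeneous f) (blin_bounded f) f0.
Qed.

HB.instance Definition _ :=
  Lmodule_isNormed.Build K blin blin_normD blin_normZ blin_norm_eq0.

End operators.

Section polynomials.
Variables (n : nat) (E F : normedModType K).

(* [dfwith x i u] is [x] with its [i]-th coordinate replaced by [u]. *)
Definition multilinear (A : ('I_n -> E) -> F) :=
  forall (x : 'I_n -> E) (i : 'I_n), linear (fun u : E => A (dfwith x i u)).

Definition homogeneous_polynomial (P : E -> F) :=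
  exists2 A : ('I_n -> E) -> F, multilinear A & forall x, P x = A (fun=> x).

Definition continuous_polynomial : {pred E -> F} :=
  fun P => `[< homogeneous_polynomial P /\ continuous P >].

Record hpoly :=
  HPoly { hpoly_fun :> E -> F ; hpolyP : hpoly_fun \in continuous_polynomial }.

HB.instance Definition _ := [isSub for hpoly_fun].
HB.instance Definition _ := [Choice of hpoly by <:].

Lemma hpoly_polynomial (P : hpoly) : homogeneous_polynomial P.
Proof. by have /asboolP[] := hpolyP P. Qed.

Lemma hpoly_continuous (P : hpoly) : continuous P.
Proof. by have /asboolP[] := hpolyP P. Qed.

Lemma continuous_polynomial_submod : submod_closed continuous_polynomial.
Proof.
split.
  apply/asboolP; split; last exact: cst_continuous.
  by exists (fun=> 0) => // x i a u v; rewrite scaler0 addr0.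
move=> a P Q /asboolP[[A lA PA] cP] /asboolP[[B lB QB] cQ].
apply/asboolP; split; last first.
  by move=> x; apply: cvgD; [apply: cvgZr; exact: cP|exact: cQ].
exists (fun x => a *: A x + B x) => [x i b u v|x]; last by rewrite -PA -QB.
by rewrite lA lB !scalerDr !scalerA [b * a]mulrC addrACA.
Qed.

HB.instance Definition _ := GRing.isSubmodClosed.Build K (E -> F)
  continuous_polynomial continuous_polynomial_submod.
HB.instance Definition _ := [SubChoice_isSubLmodule of hpoly by <:].

Lemma multilinear_homogeneous (A : ('I_n -> E) -> F) (c : K) (x : 'I_n -> E) :
  multilinear A -> A (fun i => c *: x i) = c ^+ n *: A x.
Proof.
move=> lA; have lAZ y i u : A (dfwith y i (c *: u)) = c *: A (dfwith y i u).
  have /(_ c u 0) := lA y i; have /(_ (-1) u u) := lA y i.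
  rewrite !scaleN1r !addNr !addr0 => A0 ->.
  by rewrite A0 addr0.
have H m : (m <= n)%N ->
    A (fun i : 'I_n => if (i < m)%N then c *: x i else x i) = c ^+ m *: A x.
  elim: m => [_|m IH mn]; first by rewrite expr0 scale1r.
  pose y (i : 'I_n) := if (i < m)%N then c *: x i else x i.
  pose j := Ordinal mn.
  have -> : (fun i : 'I_n => if (i < m.+1)%N then c *: x i else x i) =
      dfwith y j (c *: x j).
    apply/funext => i; case: dfwithP => [|{}i ji].
      by rewrite /= ltnS leqnn.
    rewrite /y ltnS leq_eqVlt.
    by case: eqP => // im; case/eqP: ji; apply/val_inj.
  rewrite lAZ exprS -scalerA -IH; last exact: ltnW.
  congr (_ *: A _); apply/funext => i; case: dfwithP => //.
  by rewrite /j /= ltnn.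
rewrite -H //; congr A; apply/funext => i.
by rewrite ltn_ord.
Qed.

Lemma hpoly_homogeneous (P : hpoly) (c : K) x : P (c *: x) = c ^+ n *: P x.
Proof.
by have [A lA PA] := hpoly_polynomial P; rewrite !PA multilinear_homogeneous.
Qed.

Lemma hpoly_bounded (P : hpoly) : ball_bounded P.
Proof.
exact: homogeneous_bounded (hpoly_homogeneous P) (@hpoly_continuous P 0).
Qed.

Definition hpoly_norm (P : hpoly) : K := ball_sup P.

Let hpoly_normD P Q : hpoly_norm (P + Q) <= hpoly_norm P + hpoly_norm Q.
Proof. exact: ball_supD (hpoly_bounded P) (hpoly_bounded Q). Qed.

Let hpoly_normZ (l : K) P : hpoly_norm (l *: P) = `|l| * hpoly_norm P.
Proof. exact: ball_supZ (hpoly_bounded P). Qed.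

Let hpoly_norm_eq0 P : hpoly_norm P = 0 -> P = 0.
Proof.
move=> P0; apply/val_inj.
exact: homogeneous_eq0 (hpoly_homogeneous P) (hpoly_bounded P) P0.
Qed.

HB.instance Definition _ :=
  Lmodule_isNormed.Build K hpoly hpoly_normD hpoly_normZ hpoly_norm_eq0.

End polynomials.

Definition dual (E : normedModType K) := blin E K^o.

Section adjoint.
Variables (E G : normedModType K) (S : blin E G).

Lemma adjoint_subproof (phi : dual G) :
  (phi \o S : E -> K^o) \in @bounded_linear E K^o.
Proof.
apply/asboolP; split=> [a x y|]; first by rewrite /= !linearP.
move=> x; apply: continuous_comp; first exact: blin_continuous.
exact: blin_continuous.
Qed.

Definition adjoint (phi : dual G) : dual E := Blin (adjoint_subproof phi).

End adjoint.

Definition weak (E : normedModType K) : topologicalType :=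
  initial_topology ((fun x phi => phi x) : E -> {ptws dual E -> K^o}).

Definition weakly_precompact (E : normedModType K) (A : set E) :=
  @precompact (weak E) A.

Section compact_polynomials.
Variables (n : nat) (E F : normedModType K).

Definition compact_polys : set (hpoly n E F) :=
  [set P | forall B : set E, bounded_set B -> precompact (P @` B)].

Definition weakly_compact_polys : set (hpoly n E F) :=
  [set P | forall B : set E, bounded_set B -> weakly_precompact (P @` B)].

End compact_polynomials.

Definition complemented (V : normedModType K) (M : set V) :=
  exists2 T : blin V V, (forall v, T (T v) = T v) & range T = M.

Section bases.
Variable F : normedModType K.
Implicit Types x : nat -> F.

Definition schauder_basis_of (V : set F) x :=
  (forall i, V (x i)) /\
  forall v, V v ->
    exists! a : nat -> K, series (fun i => a i *: x i) @ \oo --> v.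

Definition closed_span x : set F :=
  closure [set v | exists N (a : nat -> K), v = \sum_(i < N) a i *: x i].

Definition seminormalized_basic_sequence x :=
  schauder_basis_of (closed_span x) x /\
  exists a b : K, 0 < a /\ forall i, a < `|x i| < b.

Definition unconditional_basis x :=
  schauder_basis_of setT x /\
  forall a : nat -> K, cvgn (series (fun i => a i *: x i)) ->
    forall s : nat -> nat, bijective s ->
      cvgn (series (fun i => a (s i) *: x (s i))).

(* For a Schauder basis [x], uniqueness of expansions determines [x']. *)
Definition coordinate_functionals x (x' : nat -> dual F) :=
  forall v, series (fun i => x' i v *: x i) @ \oo --> v.

End bases.
End spaces.

(* Main.v *)
(* Put [phi_i = S' g'_i] and [f_i = R g_i]. Unconditionality makes
   [T_A x = sum_(i in A) phi_i(x) f_i], for A a set of indices, a uniformly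
   bounded family of operators, and the basic sequence [f] has uniformly bounded
   biorthogonal functionals [r_i] on F. Fix [phi_0] in E', nonzero, and let
   [Q_A = phi_0^(n-1) T_A], which equals [T_A] on the hyperplane [phi_0 = 1].
   If Pi is a projection onto the (weakly) compact polynomials, the functions
   [A |-> r_i ((Q_A - Pi Q_A) x_l)], for points [x_l] of that hyperplane, are
   bounded, finitely additive, and vanish on singletons; as there are countably
   many of them, an almost disjoint family yields an infinite M inside any given
   infinite set on which all of them vanish. So the polynomial [P = Pi Q_M] is
   (weakly) compact and satisfies [r_i (P x_l) = phi_i(x_l)] for i in M and all l.
   Since [phi_i -> 0] pointwise, [r_i -> 0] along M on the closed span of the
   [P x_l].
   (a) If the [phi_i] are not relatively compact they are not norm null, and the
   [x_l] can be chosen with [|phi_l(x_l)| >= e]; a cluster point of the [P x_l],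
   l in M, contradicts the previous sentence.
   (b) If they are not relatively weakly compact they are not weakly null, say
   [|Phi(phi_i)| >= e] for infinitely many i, and Helly's theorem gives bounded
   [x_l] with [phi_i(x_l) = Phi(phi_i)] for i <= l. A weak cluster point y of the
   [P x_l] has [|r_i y|] bounded below for i in M, although it lies in their
   closed span. *)
Require Import Defs.
From HB Require Import structures.
From mathcomp Require Import all_boot all_order all_algebra.
From mathcomp Require Import complex.
From mathcomp Require Import all_classical all_reals all_analysis.
From mathcomp Require Import ring lra zify.

Set Implicit Arguments.
Unset Strict Implicit.
Unset Printing Implicit Defensive.

Import Order.TTheory GRing.Theory Num.Theory.
Import numFieldNormedType.Exports.

Local Open Scope classical_set_scope.
Local Open Scope ring_scope.

(** * Real-valued norms *)

Section real_scalars.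
Variables (rT : realType) (k : scalar_kind).
Local Notation K := (scalar_field rT k).

(* Norms are compared in [rT], because the order of [R[i]] is only partial. *)
Definition ofreal (r : rT) : K :=
  match k return scalar_field rT k with
  | RealScalars => r | ComplexScalars => (r%:C)%C end.

Definition realpart : K -> rT :=
  match k return scalar_field rT k -> rT with
  | RealScalars => id | ComplexScalars => @complex.Re rT end.

(* Junk value [0] over the reals: [scalarE] and the definition of a functional
   from its real part then hold for both kinds of scalars. *)
Definition imunit : K :=
  match k return scalar_field rT k with
  | RealScalars => 0 | ComplexScalars => 'i%C end.

Lemma ofrealK : cancel ofreal realpart.
Proof. by rewrite /ofreal /realpart; case: k. Qed.

Lemma ofrealD r s : ofreal (r + s) = ofreal r + ofreal s.
Proof. by rewrite /ofreal; case: k => //=; rewrite rmorphD. Qed.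

Lemma ofrealN r : ofreal (- r) = - ofreal r.
Proof. by rewrite /ofreal; case: k => //=; rewrite rmorphN. Qed.

Lemma ofrealM r s : ofreal (r * s) = ofreal r * ofreal s.
Proof. by rewrite /ofreal; case: k => //=; rewrite rmorphM. Qed.

Lemma ofreal1 : ofreal 1 = 1.
Proof. by rewrite /ofreal; case: k. Qed.

Lemma ofreal0 : ofreal 0 = 0.
Proof. by rewrite /ofreal; case: k. Qed.

Lemma ler_ofreal r s : (ofreal r <= ofreal s) = (r <= s).
Proof. by rewrite /ofreal; case: k => //=; rewrite lecR. Qed.

Lemma ltr_ofreal r s : (ofreal r < ofreal s) = (r < s).
Proof. by rewrite /ofreal; case: k => //=; rewrite ltcR. Qed.

Lemma realpartD a b : realpart (a + b) = realpart a + realpart b.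
Proof. by move: a b; rewrite /realpart; case: k => //= -[? ?] [? ?]. Qed.

Lemma realpartN a : realpart (- a) = - realpart a.
Proof. by move: a; rewrite /realpart; case: k => //= -[? ?]. Qed.

Lemma realpartB a b : realpart (a - b) = realpart a - realpart b.
Proof. by rewrite realpartD realpartN. Qed.

Lemma realpart0 : realpart 0 = 0.
Proof. by rewrite /realpart; case: k. Qed.

Lemma realpartZ r a : realpart (ofreal r * a) = r * realpart a.
Proof.
move: a; rewrite /realpart /ofreal; case: k => //= -[? ?] /=.
by rewrite mul0r subr0.
Qed.

Lemma realpart_imunit r : realpart (imunit * ofreal r) = 0.
Proof.
rewrite /realpart /imunit /ofreal; case: k => /=; first by rewrite mul0r.
by rewrite !mul0r mulr0 subr0.
Qed.

(** Since Re(ia) = - Im a, a scalar is determined by real parts alone. This turns a real functional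
    into a [K]-linear one and lets real set functions test scalar equations. *)
Lemma scalarE a :
  a = ofreal (realpart a) - imunit * ofreal (realpart (imunit * a)).
Proof.
move: a; rewrite /realpart /imunit /ofreal; case: k => [a|[a b]] /=.
  by rewrite mul0r subr0.
by simpc; congr (_ +i* _)%C.
Qed.

Lemma imunitP : imunit = 0 \/ imunit * imunit = -1.
Proof.
rewrite /imunit; case: k; [by left|right].
by rewrite -expr2 complex.sqr_i.
Qed.

Lemma ger0_ofreal a : 0 <= a -> a = ofreal (realpart a).
Proof.
move: a; rewrite /realpart /ofreal; case: k => // -[a b] /=.
by rewrite lecE /= => /andP[/eqP -> _].
Qed.

Lemma realpart_le_norm a : realpart a <= realpart `|a|.
Proof.
move: a; rewrite /realpart; case: k => [a|[a b]] /=; first exact: ler_norm.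
rewrite (le_trans (ler_norm _))// -sqrtr_sqr ler_sqrt ?addr_ge0 ?sqr_ge0//.
by rewrite lerDl sqr_ge0.
Qed.

End real_scalars.

Arguments ofreal {rT} k r.
Arguments imunit {rT} k.

Section real_norm.
Variables (rT : realType) (k : scalar_kind).
Local Notation K := (scalar_field rT k).

Definition rnorm (V : normedModType K) (v : V) : rT := realpart `|v|.

Variable V : normedModType K.
Implicit Types v w : V.

Lemma rnormE v : `|v| = ofreal k (rnorm v).
Proof. exact: ger0_ofreal. Qed.

Lemma rnorm_ge0 v : 0 <= rnorm v.
Proof. by rewrite -(ler_ofreal k) ofreal0 -rnormE. Qed.

Lemma rnormD v w : rnorm (v + w) <= rnorm v + rnorm w.
Proof. by rewrite -(ler_ofreal k) ofrealD -!rnormE ler_normD. Qed.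

Lemma rnormN v : rnorm (- v) = rnorm v.
Proof. by rewrite /rnorm normrN. Qed.

Lemma rnormB v w : rnorm (v - w) <= rnorm v + rnorm w.
Proof. by rewrite -(rnormN w) rnormD. Qed.

Lemma rdistC v w : rnorm (v - w) = rnorm (w - v).
Proof. by rewrite -rnormN opprB. Qed.

Lemma rdistD u v w : rnorm (v - w) <= rnorm (v - u) + rnorm (u - w).
Proof. by rewrite (le_trans _ (rnormD _ _))// addrA subrK. Qed.

Lemma rnorm0 : rnorm (0 : V) = 0.
Proof. by rewrite /rnorm normr0 realpart0. Qed.

Lemma rnorm_eq0 v : (rnorm v == 0) = (v == 0).
Proof.
apply/eqP/eqP => [v0|->]; last exact: rnorm0.
by apply/normr0_eq0; rewrite rnormE v0 ofreal0.
Qed.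

Lemma rnorm_gt0 v : (0 < rnorm v) = (v != 0).
Proof. by rewrite lt_def rnorm_eq0 rnorm_ge0 andbT. Qed.

Lemma rnormZ (a : K) v : rnorm (a *: v) = rnorm (a : K^o) * rnorm v.
Proof.
by rewrite {1}/rnorm normrZ (rnormE v) (ger0_ofreal (normr_ge0 a)) realpartZ
  ofrealK.
Qed.

Lemma rnorm_ofreal (r : rT) : rnorm (ofreal k r : K^o) = `|r|.
Proof.
rewrite /rnorm; case: (lerP 0 r) => r0.
  have := ler_ofreal k 0 r; rewrite ofreal0 r0 => r0'.
  by rewrite (ger0_norm r0') ofrealK ger0_norm.
have := ltr_ofreal k r 0; rewrite ofreal0 r0 => r0'.
by rewrite (ltr0_norm r0') -ofrealN ofrealK ltr0_norm.
Qed.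

Lemma rnormZr (r : rT) v : rnorm (ofreal k r *: v) = `|r| * rnorm v.
Proof. by rewrite rnormZ rnorm_ofreal. Qed.

Lemma norm_realpart_le (a : K) : `|realpart a| <= rnorm (a : K^o).
Proof.
by rewrite ler_norml lerNl -realpartN /rnorm -{1}(normrN a) !realpart_le_norm.
Qed.

Lemma rnorm_sum I (s : seq I) (P : pred I) (F : I -> V) :
  rnorm (\sum_(i <- s | P i) F i) <= \sum_(i <- s | P i) rnorm (F i).
Proof.
elim/big_ind2 : _ => [|v x w y vx wy|//]; first by rewrite rnorm0.
by rewrite (le_trans (rnormD _ _))// lerD.
Qed.

Lemma cvg_rnormP (u : nat -> V) l : u @ \oo --> l <->
  forall e : rT, 0 < e -> exists n, forall m, (n <= m)%N -> rnorm (u m - l) < e.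
Proof.
split=> [ul e e0|H].
  have e0' : 0 < ofreal k e by rewrite -(ofreal0 rT k) ltr_ofreal.
  move/cvgrPdistC_lt : ul => /(_ _ e0')[n _ Hn]; exists n => m /Hn /=.
  by rewrite rnormE ltr_ofreal.
apply/cvgrPdistC_lt => e e0.
have := H (realpart e); rewrite -(ltr_ofreal k) ofreal0 -ger0_ofreal ?ltW//.
move=> /(_ e0)[n Hn]; exists n => // m /Hn.
by rewrite rnormE -(ltr_ofreal k) -(ger0_ofreal (ltW e0)).
Qed.

Lemma nbhs_rnormP (v : V) (A : set V) : nbhs v A <->
  exists2 e : rT, 0 < e & forall w, rnorm (w - v) < e -> A w.
Proof.
split=> [/nbhs_normP[e /= e0 eA]|[e e0 eA]].
  exists (realpart e).
    by rewrite -(ltr_ofreal k) ofreal0 -ger0_ofreal ?ltW.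
  move=> w; rewrite -(ltr_ofreal k) -(ger0_ofreal (ltW e0)) -rnormE => we.
  by apply: eA; rewrite /= distrC.
apply/nbhs_normP; exists (ofreal k e) => /=;
  first by rewrite -(ofreal0 rT k) ltr_ofreal.
by move=> w /=; rewrite distrC rnormE ltr_ofreal; exact: eA.
Qed.

End real_norm.

Section continuity.
Variables (rT : realType) (k : scalar_kind).
Local Notation K := (scalar_field rT k).
Variables V W : normedModType K.

Lemma continuous_rnormP (f : V -> W) v :
  {for v, continuous f} <-> forall e : rT, 0 < e -> exists2 d : rT, 0 < d &
    forall w, rnorm (w - v) < d -> rnorm (f w - f v) < e.
Proof.
split=> [fv e e0|H A /nbhs_rnormP[e e0 eA]].
  have fe : nbhs (f v) [set w | rnorm (w - f v) < e].
    by apply/nbhs_rnormP; exists e.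
  by have /nbhs_rnormP := fv _ fe.
apply/nbhs_rnormP; have [d d0 dP] := H e e0; exists d => // w /dP; exact: eA.
Qed.

Lemma linear_rnorm_continuous (f : {linear V -> W}) (C : rT) :
  (forall v, rnorm (f v) <= C * rnorm v) -> continuous f.
Proof.
move=> fC v; apply/continuous_rnormP => e e0.
have C0 : 0 < `|C| + 1 by rewrite ltr_wpDl.
exists (e / (`|C| + 1)); first by rewrite divr_gt0.
move=> w; rewrite ltr_pdivlMr// -linearB; apply: le_lt_trans.
rewrite (le_trans (fC _))// mulrC ler_wpM2l ?rnorm_ge0//.
by rewrite (le_trans (ler_norm _))// lerDl.
Qed.

End continuity.

Section complete.
Variables (rT : realType) (k : scalar_kind).
Local Notation K := (scalar_field rT k).
Variable V : completeNormedModType K.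

Lemma rnorm_complete (u : nat -> V) :
  (forall e : rT, 0 < e -> exists n, forall m, (n <= m)%N -> rnorm (u m - u n) <
    e) ->
  exists l : V, u @ \oo --> l.
Proof.
move=> H; suff /cvg_ex[l ul] : cvgn u by exists l.
apply/cauchy_cvgP/cauchy_exP => e e0.
have e0' : 0 < realpart e.
  by rewrite -(ltr_ofreal k) ofreal0 -ger0_ofreal ?ltW.
have [n Hn] := H _ e0'.
exists (u n); exists n => // m /= nm; rewrite -ball_normE /=.
by rewrite distrC rnormE (ger0_ofreal (ltW e0)) ltr_ofreal Hn.
Qed.

End complete.

(** * Norm estimates for operators and homogeneous polynomials *)

Section bounds.
Variables (rT : realType) (k : scalar_kind).
Local Notation K := (scalar_field rT k).
Variables E F : normedModType K.

Lemma homogeneous_ball_sup n (f : E -> F) x :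
  (forall (c : K) x, f (c *: x) = c ^+ n *: f x) -> ball_bounded f ->
  `|f x| <= ball_sup f * `|x| ^+ n.
Proof.
move=> fh fb; have [->|x0] := eqVneq x 0.
  (* Homogeneity at 0 treats [n = 0], where [0 ^+ 0 = 1], together with positive degrees. *)
  have -> : f 0 = 0 ^+ n *: f 0 by rewrite -fh scaler0.
  rewrite normrZ normrX !normr0 mulrC ler_wpM2r ?exprn_ge0//.
  by apply: ball_sup_ge => //; rewrite normr0.
have nx : `|x| != 0 by rewrite normr_eq0.
have {1}-> : x = `|x| *: (`|x|^-1 *: x) by rewrite scalerA divff ?scale1r.
rewrite fh normrZ normrX normr_id mulrC ler_wpM2r ?exprn_ge0//.
by apply: ball_sup_ge => //; rewrite normrZ normfV normr_id mulVf.
Qed.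

Lemma blin_rnorm (f : blin E F) x : rnorm (f x) <= rnorm f * rnorm x.
Proof.
have := homogeneous_ball_sup x (blin_homogeneous f) (blin_bounded f).
rewrite -[ball_sup f]/(`|f|) expr1 !rnormE -ofrealM.
by rewrite ler_ofreal.
Qed.

Lemma blin_rnorm_le (f : blin E F) C :
  (forall x, rnorm x <= 1 -> rnorm (f x) <= C) -> rnorm f <= C.
Proof.
move=> fC; rewrite -(ler_ofreal k) -rnormE; apply: ball_sup_le.
  exact: blin_bounded.
by move=> x; rewrite !rnormE ler_ofreal -(ofreal1 rT k) ler_ofreal; exact: fC.
Qed.

Lemma hpoly_rnorm n (P : hpoly n E F) x : rnorm (P x) <= rnorm P * rnorm x ^+ n.
Proof.
have := homogeneous_ball_sup x (hpoly_homogeneous P) (hpoly_bounded P).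
rewrite -[ball_sup P]/(`|P|) !rnormE.
have -> : ofreal k (rnorm x) ^+ n = ofreal k (rnorm x ^+ n).
  by elim: n {P} => [|n IH]; rewrite ?expr0 ?ofreal1// !exprS IH ofrealM.
by rewrite -ofrealM ler_ofreal.
Qed.

Lemma hpoly_rnorm_le n (P : hpoly n E F) C :
  (forall x, rnorm x <= 1 -> rnorm (P x) <= C) -> rnorm P <= C.
Proof.
move=> fC; rewrite -(ler_ofreal k) -rnormE; apply: ball_sup_le.
  exact: hpoly_bounded.
by move=> x; rewrite !rnormE ler_ofreal -(ofreal1 rT k) ler_ofreal; exact: fC.
Qed.

Lemma blinZ (a : K) (f : blin E F) x : (a *: f) x = a *: f x.
Proof. by []. Qed.

Lemma blin0 x : (0 : blin E F) x = 0.
Proof. by []. Qed.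

Lemma hpolyD n (f g : hpoly n E F) x : (f + g) x = f x + g x.
Proof. by []. Qed.

Lemma bounded_linear_blin (f : E -> F) (C : rT) : linear f ->
  (forall x, rnorm (f x) <= C * rnorm x) -> exists T : blin E F, T =1 f.
Proof.
move=> lf fC.
pose f' : {linear E -> F} := HB.pack f (GRing.isLinear.Build _ _ _ _ _ lf).
have fP : f \in @bounded_linear rT k E F.
  by apply/asboolP; split => //; exact: (@linear_rnorm_continuous _ _ _ _ f' C).
by exists (Blin fP).
Qed.

End bounds.

Section subspaces.
Variables (rT : realType) (k : scalar_kind).
Local Notation K := (scalar_field rT k).
Variable V : normedModType K.
Implicit Types v w : V.

Definition subspace (M : set V) :=
  [/\ M 0, (forall v w, M v -> M w -> M (v + w)) &
      forall (a : K) v, M v -> M (a *: v)].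

Definition rclosed (M : set V) :=
  forall v, (forall e : rT, 0 < e -> exists2 w, M w & rnorm (v - w) < e) -> M v.

End subspaces.

(** * Zabreiko's lemma *)

Lemma geometric_small (rT : realType) (c e : rT) : 0 < e ->
  exists n, forall m, (n <= m)%N -> c / 2 ^+ m < e.
Proof.
move=> e0; exists (Num.truncn (`|c| / e)).+1 => m nm.
rewrite ltr_pdivrMr ?exprn_gt0// mulrC -ltr_pdivrMr//.
rewrite (le_lt_trans (ler_wpM2r _ (ler_norm c))) ?invr_ge0 ?ltW//.
rewrite (lt_le_trans (truncnS_gt _))// -natrX ler_nat.
by rewrite (leq_trans nm)// ltnW// ltn_expl.
Qed.

Section limits.
Variables (rT : realType) (k : scalar_kind).
Local Notation K := (scalar_field rT k).
Variable V : normedModType K.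
Implicit Types (u : nat -> V) (c l : V).

Lemma rnorm_small (v : V) : (forall e : rT, 0 < e -> rnorm v < e) -> v = 0.
Proof.
move=> H; apply/eqP; rewrite -rnorm_eq0 eq_le rnorm_ge0 andbT leNgt.
by apply/negP => /H; rewrite ltxx.
Qed.

Lemma cvg_rnorm_le u l c (B : rT) : u @ \oo --> l ->
  (exists n, forall m, (n <= m)%N -> rnorm (u m - c) <= B) -> rnorm (l - c) <=
    B.
Proof.
move=> /cvg_rnormP ul [n uB]; rewrite leNgt; apply/negP => Bl.
have [n' ul'] := ul (rnorm (l - c) - B) ltac:(by rewrite subr_gt0).
have := rdistD (u (maxn n n')) l c.
rewrite leNgt => /negP; apply.
have := ul' _ (leq_maxr n n'); have := uB _ (leq_maxl n n').
rewrite (rdistC (u _) l); lra.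
Qed.

Lemma cvg_rnorm_unique u l l' : u @ \oo --> l -> u @ \oo --> l' -> l = l'.
Proof.
move=> ul /cvg_rnormP ul'; apply/eqP; rewrite -subr_eq0; apply/eqP.
apply: rnorm_small => e e0; have [n un] := ul' (e / 2) ltac:(lra).
rewrite (@le_lt_trans _ _ (e / 2))//; last by lra.
by apply: (cvg_rnorm_le ul); exists n => m /un/ltW.
Qed.

Lemma cvg_rnorm_linear (W : normedModType K) (f : V -> W) (C : rT) u l :
  (forall v w, rnorm (f v - f w) <= C * rnorm (v - w)) ->
  u @ \oo --> l -> f \o u @ \oo --> f l.
Proof.
move=> fC /cvg_rnormP ul; apply/cvg_rnormP => e e0.
have C0 : 0 < `|C| + 1 by rewrite ltr_wpDl.
have [|n un] := ul (e / (`|C| + 1)); first by rewrite divr_gt0.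
exists n => m /un; rewrite ltr_pdivlMr// => H.
rewrite (le_lt_trans (fC _ _))// (le_lt_trans _ H)//
  mulrC ler_wpM2l ?rnorm_ge0//.
by rewrite (le_trans (ler_norm _))// lerDl.
Qed.

Lemma subspaceB (M : set V) : subspace M -> forall v w, M v -> M w -> M (v - w).
Proof. by case=> _ D Z v w Mv Mw; apply: D => //; rewrite -scaleN1r;
  exact: Z. Qed.

Lemma subspace_sum (M : set V) : subspace M -> forall I (s : seq I) (P : pred I)
  (G : I -> V), (forall i, P i -> M (G i)) -> M (\sum_(i <- s | P i) G i).
Proof. by case=> M0 D Z I s P G PG; elim/big_ind : _. Qed.

Lemma rclosed_cvg (M : set V) : rclosed M -> forall u l, (forall n, M (u n)) ->
  u @ \oo --> l -> M l.
Proof.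
move=> cM u l Mu /cvg_rnormP ul; apply: cM => e /ul[n un].
by exists (u n) => //; rewrite rdistC un.
Qed.

End limits.

Section zabreiko.
Variables (rT : realType) (k : scalar_kind).
Local Notation K := (scalar_field rT k).
Variable V : completeNormedModType K.
Implicit Types v w : V.

(** The j-th term is at most c/2^j = 2c/2^j - 2c/2^(j+1), so distances between partial sums
    telescope and completeness applies. *)
Lemma absolute_cvg (w : nat -> V) (c : rT) :
  (forall j, rnorm (w j) <= c / 2 ^+ j) -> exists2 l : V,
    series w @ \oo --> l & forall n, rnorm (l - series w n) <= 2 * c / 2 ^+ n.
Proof.
move=> wc; have dist n m : rnorm (series w (n + m)%N - series w n) <=
    2 * c / 2 ^+ n - 2 * c / 2 ^+ (n + m)%N.
  elim: m => [|m IH]; first by rewrite addn0 !subrr rnorm0.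
  rewrite addnS /series /= big_nat_recr//= -/(series w (n + m)%N) addrAC.
  rewrite (le_trans (rnormD _ _))// (le_trans (lerD IH (wc _)))//.
  rewrite exprS invfM; set t := (_ ^+ (n + m))^-1; lra.
have c0 : 0 <= c.
  by have := wc 0%N; rewrite expr0 divr1; exact: le_trans (rnorm_ge0 _).
have dist' n m : (n <= m)%N -> rnorm (series w m - series w n) <= 2 * c / 2 ^+
  n.
  move=> nm; rewrite -(subnKC nm) (le_trans (dist _ _))// gerBl.
  by rewrite divr_ge0 ?exprn_ge0// mulr_ge0.
have [e e0|l wl] := @rnorm_complete _ _ V (series w).
  have [n nP] := geometric_small (2 * c) e0.
  by exists n => m nm; rewrite (le_lt_trans (dist' _ _ nm))// nP.
exists l => // n; apply: (cvg_rnorm_le wl); exists n => m; exact: dist'.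
Qed.

(** Baire's argument relative to [M]: if no [S n] is dense in a relative ball, shrinking balls that
    avoid [S 0], [S 1], ... in turn have centres converging to a point of [M] in none of these
    sets. *)
Lemma baire_dense_ball (M : set V) (S : nat -> set V) : M !=set0 -> rclosed M ->
  (forall v, M v -> exists n, S n v) ->
  exists n v0 (r : rT), [/\ M v0, 0 < r & forall v, M v -> rnorm (v - v0) < r ->
    forall e : rT, 0 < e -> exists w, [/\ M w, S n w & rnorm (v - w) < e]].
Proof.
move=> [v0 Mv0] cM MS; apply: contrapT => H.
have step (x : nat * (V * rT)) : exists q : V * rT, M x.2.1 -> 0 < x.2.2 ->
    [/\ M q.1, 0 < q.2, q.2 <= x.2.2 / 2, rnorm (q.1 - x.2.1) < x.2.2 &
    forall w, M w -> rnorm (w - q.1) <= 2 * q.2 -> ~ S x.1 w].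
  case: x => n [v r] /=; apply: contrapT => H1; apply: H; exists n, v, r.
  have [Mv r0] : M v /\ 0 < r.
    by split; apply: contrapT => nH; apply: H1; exists (v, r).
  split => // v' Mv' vv' e e0; apply: contrapT => H2; apply: H1.
  (* The bound e/4 keeps the ball of doubled radius inside the [e]-ball that misses [S n]; r/2 makes
     the radii decay geometrically. *)
  exists (v', Num.min (e / 4) (r / 2)) => _ _; split => //=.
  - by rewrite lt_min !divr_gt0.
  - by rewrite ge_min lexx orbT.
  - move=> w Mw wv Sw; apply: H2; exists w; split => //.
    rewrite rdistC (le_lt_trans wv)// (@le_lt_trans _ _ (2 * (e / 4)))//;
      last by lra.
    by rewrite ler_wpM2l// ge_min lexx.
have [f fP] := choice step.
pose a := fix a n := if n is m.+1 then f (m, a m) else (v0, 1).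
have aP n : M (a n).1 /\ 0 < (a n).2.
  by elim: n => [//|n [Mn rn]]; have [] := fP (n, a n) Mn rn.
have aS n := fP (n, a n) (aP n).1 (aP n).2.
have r2 n : (a n).2 <= 1 / 2 ^+ n.
  elim: n => [|n IH]; first by rewrite expr0 divr1.
  have [_ _ + _ _] := aS n; rewrite -/(a n.+1) => /le_trans; apply.
  by rewrite exprS invfM; set t := (_ ^+ n)^-1 in IH *; lra.
(* Consecutive centres are closer than r_n <= 2 r_n - 2 r_(n+1), so distances telescope. The limit
   thus stays within 2 r_n of the n-th centre, which is why [step] excludes [S] from a ball of
   doubled radius. *)
have dist n m : rnorm ((a (n + m)%N).1 - (a n).1) <=
  2 * (a n).2 - 2 * (a (n + m)%N).2.
  elim: m => [|m IH]; first by rewrite addn0 !subrr rnorm0.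
  have [_ _ + + _] := aS (n + m)%N; rewrite -/(a _.+1) addnS.
  have := rdistD (a (n + m)%N).1 (a (n + m).+1).1 (a n).1.
  by move: IH; lra.
have dist' n m : (n <= m)%N -> rnorm ((a m).1 - (a n).1) <= 2 * (a n).2.
  move=> nm; rewrite -(subnKC nm) (le_trans (dist _ _))// gerBl mulr_ge0//
    ltW//.
  by have [] := aP (n + (m - n))%N.
have [e e0|l al] := @rnorm_complete _ _ V (fun n => (a n).1).
  have [n nP] := geometric_small 2 e0.
  exists n => m nm; rewrite (le_lt_trans (dist' _ _ nm))//.
  by rewrite (le_lt_trans _ (nP n (leqnn n)))//
    -[X in _ <= X / _]mulr1 -mulrA ler_wpM2l.
have Ml : M l by apply: (rclosed_cvg cM _ al) => n; have [] := aP n.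
have [n Snl] := MS _ Ml.
have [_ _ _ _ /(_ l Ml)] := aS n; apply => //.
by apply: (cvg_rnorm_le al); exists n.+1 => m /dist'.
Qed.

(* Zabreiko's lemma; [Q c v] reads [p v <= c] for a countably subadditive
   extended seminorm [p] that is finite on [M]. *)
Lemma zabreiko (M : set V) (Q : rT -> set V) : subspace M -> rclosed M ->
  (forall v, M v -> exists c, Q c v) ->
  (forall c d v, c <= d -> Q c v -> Q d v) ->
  (forall c d v w, M v -> M w -> Q c v -> Q d w -> Q (c + d) (v - w)) ->
  (forall c r v, M v -> 0 < r -> Q c v -> Q (r * c) (ofreal k r *: v)) ->
  (forall c (w : nat -> V) v, (forall j, M (w j)) ->
     (forall j, Q (c / 2 ^+ j) (w j)) -> series w @ \oo --> v -> Q (2 * c) v) ->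
  exists2 C : rT, 0 < C & forall v, M v -> rnorm v <= 1 -> Q C v.
Proof.
move=> sM cM Qex Qle QB QZ Qsum.
have [M0 MD MZ] := sM.
have [||n [v0 [r [Mv0 r0 dense]]]] := @baire_dense_ball M (fun n => Q n%:R) _
  cM.
- by exists 0.
- move=> v /Qex[c Qc]; exists (Num.truncn c).+1; apply: (Qle c) => //.
  exact/ltW/truncnS_gt.
(* Differences of points of [Q n%:R] near [v0] approximate all small vectors of [M]; by [QB] they
   lie at level 2n. *)
pose c : rT := 2 * n%:R.
have approx v : M v -> rnorm v < r -> forall e : rT, 0 < e ->
    exists w, [/\ M w, Q c w & rnorm (v - w) < e].
  move=> Mv vr e e0.
  have e20 : 0 < e / 2 by lra.
  have [||w1 [Mw1 Qw1 vw1]] := dense (v + v0) _ _ _ e20; first exact: MD.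
    by rewrite addrK.
  have [||w0 [Mw0 Qw0 vw0]] := dense v0 _ _ _ e20 => //;
    first by rewrite subrr rnorm0.
  exists (w1 - w0); split; first exact: subspaceB.
    by rewrite /c mulr_natl mulr2n; exact: QB.
  have -> : v - (w1 - w0) = (v + v0 - w1) - (v0 - w0).
    rewrite !opprB !addrA -[LHS](addrK v0); congr (_ - _).
    by rewrite [LHS]addrAC [v + w0 + v0]addrAC [RHS]addrAC.
  by rewrite (le_lt_trans (rnormB _ _))// (splitr e) ltrD.
have scaled j v : M v -> rnorm v <= r / 2 / 2 ^+ j ->
    exists w, [/\ M w, Q (c / 2 ^+ j) w & rnorm (v - w) <= r / 2 / 2 ^+ j.+1].
  move=> Mv vr; have p0 : 0 < 2 ^+ j :> rT by rewrite exprn_gt0.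
  have [|||w [Mw Qw vw]] := approx (ofreal k (2 ^+ j) *: v) _ _ (r / 4).
  - exact: MZ.
  - rewrite rnormZr gtr0_norm// mulrC -ltr_pdivlMr// (le_lt_trans vr)//.
    by rewrite ltr_pM2r ?invr_gt0//; lra.
  - by lra.
  have q0 : 0 < (2 ^+ j : rT)^-1 by rewrite invr_gt0.
  exists (ofreal k (2 ^+ j)^-1 *: w); split; first exact: MZ.
    by rewrite mulrC; exact: QZ.
  have -> : v - ofreal k (2 ^+ j)^-1 *: w =
      ofreal k (2 ^+ j)^-1 *: (ofreal k (2 ^+ j) *: v - w).
    by rewrite scalerBr scalerA -ofrealM mulVf ?gt_eqF// ofreal1 scale1r.
  rewrite rnormZr gtr0_norm// exprS invfM.
  have -> : r / 2 * (2^-1 / 2 ^+ j) = (2 ^+ j)^-1 * (r / 4) :> rT.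
    by set t := (_ ^+ j)^-1; lra.
  by rewrite ler_wpM2l ?(ltW q0)// ltW.
(* Successive approximation, as in the open mapping theorem: each remainder is approximated at half
   the previous scale. The vector 0 is a default for pairs that violate the conditions. *)
have step (x : nat * V) : exists w, M x.2 -> rnorm x.2 <= r / 2 / 2 ^+ x.1 ->
    [/\ M w, Q (c / 2 ^+ x.1) w & rnorm (x.2 - w) <= r / 2 / 2 ^+ x.1.+1].
  have [[Mx xr]|H] := pselect (M x.2 /\ rnorm x.2 <= r / 2 / 2 ^+ x.1).
    by have [w wP] := scaled _ _ Mx xr; exists w.
  by exists 0 => Mx xr; case: H.
have [f fP] := choice step.
have Qball v : M v -> rnorm v <= r / 2 -> Q (2 * c) v.
  move=> Mv vr; pose u := fix u n := if n is j.+1 then u j - f (j, u j) else v.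
  have uP j : M (u j) /\ rnorm (u j) <= r / 2 / 2 ^+ j.
    elim: j => [|j [Mu ur]]; first by rewrite expr0 divr1.
    by have [Mf _ uf] := fP (j, u j) Mu ur; split => //=; exact: subspaceB.
  have wP j := fP (j, u j) (uP j).1 (uP j).2.
  apply: (Qsum c (fun j => f (j, u j))); [by move=> j; case: (wP j)..|].
  have serE i : series (fun j => f (j, u j)) i = v - u i.
    elim: i => [|i IH]; first by rewrite /series /= big_geq// subrr.
    by rewrite seriesSr IH /= opprB addrA addrAC -addrA; congr (_ + _);
      rewrite addrC.
  apply/cvg_rnormP => e /(geometric_small (r / 2))[i iP]; exists i => m im.
  rewrite serE addrAC subrr add0r rnormN (le_lt_trans (uP m).2)//; exact: iP.
exists (2 / r * (2 * c) + 1).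
  by rewrite ltr_wpDl// !mulr_ge0// ?invr_ge0 ltW.
move=> v Mv v1; apply: (Qle (2 / r * (2 * c))); first by rewrite lerDl.
have -> : v = ofreal k (2 / r) *: (ofreal k (r / 2) *: v).
  by rewrite scalerA -ofrealM mulrA divfK ?gt_eqF// divff// ofreal1 scale1r.
apply: QZ; [exact: MZ|by rewrite divr_gt0|].
apply: Qball; first exact: MZ.
by rewrite rnormZr gtr0_norm ?divr_gt0// ler_piMr// divr_ge0// ltW.
Qed.

End zabreiko.

(** * The Hahn-Banach theorem *)

Section sublinear.
Variables (rT : realType) (k : scalar_kind).
Local Notation K := (scalar_field rT k).
Variable E : normedModType K.
Implicit Types (x y z w : E) (p q : E -> rT).

(** Positive homogeneity is recorded as one inequality; applying it to r^-1 gives the equality of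
    [sublinearZ]. *)
Definition sublinear q := (forall x y, q (x + y) <= q x + q y) /\
  forall r x, 0 < r -> q (ofreal k r *: x) <= r * q x.

Lemma sublinear0 q : sublinear q -> q 0 = 0.
Proof.
move=> [qD qZ]; apply/eqP; rewrite eq_le.
have := qZ 2^-1 0 ltac:(by rewrite invr_gt0); rewrite scaler0.
have := qD 0 0; rewrite addr0; lra.
Qed.

Lemma sublinearN q x : sublinear q -> - q (- x) <= q x.
Proof.
move=> sq; have := sublinear0 sq; have := sq.1 x (- x); rewrite subrr; lra.
Qed.

Lemma sublinearZ q r x : sublinear q -> 0 <= r -> q (ofreal k r *: x) = r * q x.
Proof.
move=> sq; rewrite le_eqVlt => /predU1P[<-|r0].
  by rewrite ofreal0 scale0r sublinear0// mul0r.
apply/eqP; rewrite eq_le sq.2// andTb.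
have := sq.2 r^-1 (ofreal k r *: x); rewrite invr_gt0 => /(_ r0).
by rewrite scalerA -ofrealM mulVf ?gt_eqF// ofreal1 scale1r ler_pdivlMl.
Qed.

(** The witness is q'(x) = inf of q(x + u) - t over (u, t) in [W], bounded below by -q(-x). As [W]
    is a convex cone, the infimum is again sublinear. *)
Lemma sublinear_inf q (W : set (E * rT)) : sublinear q -> W (0, 0) ->
  (forall u v, W u -> W v -> W (u.1 + v.1, u.2 + v.2)) ->
  (forall r u, 0 < r -> W u -> W (ofreal k r *: u.1, r * u.2)) ->
  (forall u, W u -> u.2 <= q u.1) ->
  exists2 q', sublinear q' & forall x u, W u -> q' x <= q (x + u.1) - u.2.
Proof.
move=> sq W0 WD WZ Wq; have [qD qZ] := sq.
pose A x := [set q (x + u.1) - u.2 | u in W].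
have Alb x : has_inf (A x).
  split; first by exists (q (x + 0) - 0), (0, 0).
  exists (- q (- x)) => _ [u Wu <-].
  have := Wq _ Wu; have := qD (- x) (x + u.1); rewrite addrA addNr add0r; lra.
have inf_le x u : W u -> inf (A x) <= q (x + u.1) - u.2.
  by move=> Wu; apply: (ge_inf (Alb x).2); exists u.
exists (fun x => inf (A x)) => //; split => [x y|r x r0].
  apply/ler_addgt0Pr => e e0; have e20 : 0 < e / 2 by lra.
  have [_ [u Wu <-] ux] := inf_adherent e20 (Alb x).
  have [_ [v Wv <-] vy] := inf_adherent e20 (Alb y).
  have := inf_le (x + y) _ (WD _ _ Wu Wv); have := qD (x + u.1) (y + v.1).
  rewrite /= addrACA; lra.
apply/ler_addgt0Pr => e e0; have er0 : 0 < e / r by rewrite divr_gt0.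
have [_ [u Wu <-] ux] := inf_adherent er0 (Alb x).
have := inf_le (ofreal k r *: x) _ (WZ _ _ r0 Wu); rewrite /= -scalerDr.
rewrite sublinearZ ?(ltW r0)// => /le_trans; apply.
move: ux; rewrite -(ltr_pM2l r0) mulrDr mulrN mulrDr [r * (e / r)]mulrC divfK
  ?gt_eqF//.
lra.
Qed.

(* Hahn-Banach without partial functionals: a minimal sublinear function is
   linear, since [q'(z) = inf_(t >= 0) q(z + t y) - t q(y)] is sublinear
   and below [q]. *)
Lemma minimal_sublinear p : sublinear p -> exists q, [/\ sublinear q,
  (forall x, q x <= p x) &
  forall q', sublinear q' -> (forall x, q' x <= q x) -> q' = q].
Proof.
move=> sp; pose T := {q | sublinear q /\ forall x, q x <= p x}.
(* The order is reversed, so that Zorn's lemma yields a minimal element. *)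
pose R (q1 q2 : T) := `[< forall x, sval q2 x <= sval q1 x >].
have sval_inj (q1 q2 : T) : sval q1 = sval q2 -> q1 = q2.
  by case: q1 q2 => [q1 h1] [q2 h2] /= e; subst; congr exist;
    exact: Prop_irrelevance.
have [q1|q1 q2 q3 /asboolP h1 /asboolP h2|q1 q2 /asboolP h1 /asboolP h2|A totA|
  [q [sq qp]] qmin] := @Zorn T R.
- by apply/asboolP.
- by apply/asboolP => x; exact: le_trans (h2 x) (h1 x).
- by apply/sval_inj/funext => x; apply/eqP; rewrite eq_le h1 h2.
- have [[q0 Aq0]|A0] := pselect (A !=set0); last first.
    by exists (exist _ p (conj sp (fun x => lexx _))) => s As; case: A0;
      exists s.
  (* A nonempty chain is bounded by its pointwise infimum, which stays subadditive because any two
     members are comparable. *)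
  pose B x := [set sval q x | q in A].
  have Binf x : has_inf (B x).
    split; first by exists (sval q0 x), q0.
    exists (- p (- x)) => _ [q Aq <-]; have [sq qp] := svalP q.
    by rewrite (le_trans _ (sublinearN x sq))// lerN2.
  have inf_le x (q : T) : A q -> inf (B x) <= sval q x.
    by move=> Aq; apply: (ge_inf (Binf x).2); exists q.
  have sB : sublinear (fun x => inf (B x)).
    split=> [x y|r x r0].
      apply/ler_addgt0Pr => e e0; have e20 : 0 < e / 2 by lra.
      have [_ [q1 Aq1 <-] q1x] := inf_adherent e20 (Binf x).
      have [_ [q2 Aq2 <-] q2y] := inf_adherent e20 (Binf y).
      have [/asboolP h|/asboolP h] := totA _ _ Aq1 Aq2.
        have := inf_le (x + y) _ Aq2; have := (svalP q2).1.1 x y; have := h x;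
          lra.
      have := inf_le (x + y) _ Aq1; have := (svalP q1).1.1 x y; have := h y;
        lra.
    rewrite mulrC -ler_pdivrMr//; apply: (lb_le_inf (Binf x).1) => _ [q Aq <-].
    by rewrite ler_pdivrMr// mulrC (le_trans (inf_le _ _ Aq))// (svalP q).1.2.
  have Bp x : inf (B x) <= p x by apply: le_trans (inf_le _ _ Aq0)
    ((svalP q0).2 x).
  by exists (exist _ (fun x => inf (B x)) (conj sB Bp)) => q Aq;
    apply/asboolP => x /=; exact: inf_le.
exists q; split => // q' sq' q'q.
have q'p x : q' x <= p x by exact: le_trans (q'q x) (qp x).
have := qmin (exist _ q' (conj sq' q'p)).
by move=> /(_ ltac:(by apply/asboolP))/(congr1 sval).
Qed.

Lemma sublinear_dominates_linear p : sublinear p -> exists q,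
  [/\ (forall x y, q (x + y) = q x + q y),
      (forall (r : rT) x, q (ofreal k r *: x) = r * q x) & forall x,
        q x <= p x].
Proof.
move=> /minimal_sublinear[q [sq qp qmin]].
have qD x y : q (x + y) = q x + q y.
  apply/eqP; rewrite eq_le sq.1 /=.
  (* The ray through (y, q(y)): minimality forces q' = q, and t = 1 then reads q(x) <= q(x + y) -
     q(y). *)
  pose W := [set (ofreal k t *: y, t * q y) | t in [set t | 0 <= t]].
  have [||||q' sq' q'W] := @sublinear_inf q W sq.
  - by exists 0; rewrite /= ?ofreal0 ?scale0r ?mul0r.
  - move=> _ _ [s /= s0 <-] [t /= t0 <-]; exists (s + t) => /=;
    first exact: addr_ge0.
    by rewrite ofrealD scalerDl mulrDl.
  - move=> r _ r0 [s /= s0 <-]; exists (r * s) => /=;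
    first by rewrite mulr_ge0// ltW.
    by rewrite ofrealM scalerA mulrA.
  - by move=> _ [t /= t0 <-] /=; rewrite sublinearZ.
  have q'q : q' = q.
    apply: qmin => // z; have := q'W z (0, 0); rewrite addr0 subr0; apply.
    by exists 0; rewrite /= ?ofreal0 ?scale0r ?mul0r.
  have := q'W x (y, q y); rewrite q'q /= => H; rewrite -lerBrDr; apply: H.
  by exists 1; rewrite /= ?ler01// ofreal1 scale1r mul1r.
exists q; split => // r x.
have qN z : q (- z) = - q z.
  by have := qD z (- z); rewrite subrr (sublinear0 sq); lra.
have [r0|r0] := leP 0 r; first by rewrite sublinearZ.
by rewrite -{1}[r]opprK ofrealN scaleNr qN sublinearZ ?oppr_ge0 ?ltW//
  mulNr opprK.
Qed.

(** Take a real-linear q below p(x) = inf of |x + z + t x0| - t d over z in [M] and t >= 0. It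
    vanishes on [M] (t = 0), and p(-x0) <= -d gives q(x0) >= d (z = 0, t = 1). It is then the real
    part of the functional sought. *)
Lemma separating_functional (M : set E) x0 (d : rT) : subspace M ->
  (forall z, M z -> d <= rnorm (x0 - z)) ->
  exists psi : dual E, [/\ forall x, rnorm (psi x) <= rnorm x,
    forall z, M z -> psi z = 0 & d <= rnorm (psi x0)].
Proof.
move=> [M0 MD MZ] Md.
have sn : sublinear (@rnorm rT k E).
  by split=> [|r x r0]; [exact: rnormD|rewrite rnormZr gtr0_norm].
pose W := [set u : E * rT | exists z t, [/\ M z, 0 <= t &
  u = (z + ofreal k t *: x0, t * d)]].
have [||||p sp pW] := @sublinear_inf (@rnorm rT k E) W sn.
- by exists 0, 0; rewrite ofreal0 scale0r addr0 mul0r.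
- move=> _ _ [z [t [Mz t0 ->]]] [z' [t' [Mz' t'0 ->]]].
  exists (z + z'), (t + t'); split; [exact: MD|exact: addr_ge0|].
  by rewrite /= addrACA ofrealD scalerDl mulrDl.
- move=> r _ r0 [z [t [Mz t0 ->]]]; exists (ofreal k r *: z), (r * t).
  split; [exact: MZ|by rewrite mulr_ge0// ltW|].
  by rewrite /= scalerDr scalerA ofrealM mulrA.
- move=> _ [z [t [Mz t0 ->]]] /=.
  move: t0; rewrite le_eqVlt => /predU1P[<-|t0];
    first by rewrite mul0r rnorm_ge0.
  have -> : z + ofreal k t *: x0 =
      ofreal k t *: (x0 - ofreal k (- t^-1) *: z).
    rewrite ofrealN scaleNr opprK scalerDr scalerA -ofrealM divff ?gt_eqF//.
    by rewrite ofreal1 scale1r addrC.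
  by rewrite rnormZr gtr0_norm// ler_pM2l// Md//; exact: MZ.
have [q [qD qZ qp]] := sublinear_dominates_linear sp.
have qW x z t : M z -> 0 <= t -> q x <= rnorm (x + (z + ofreal k t *: x0)) - t *
  d.
  by move=> Mz t0; rewrite (le_trans (qp x))// (pW x (_, _))//; exists z, t.
have qn x : q x <= rnorm x.
  by have := qW x 0 0 M0 (lexx _); rewrite ofreal0 scale0r !addr0 mul0r subr0.
have qN x : q (- x) = - q x.
  by have := qZ (-1) x; rewrite ofrealN ofreal1 scaleN1r mulN1r.
have qM z : M z -> q z = 0.
  have H w : M w -> q w <= 0.
    move=> Mw; have := qW w (- w) 0 _ (lexx _);
      rewrite -scaleN1r => /(_ (MZ _ _ Mw)).
    by rewrite ofreal0 scale0r addr0 mul0r subr0 scaleN1r subrr rnorm0.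
  move=> Mz; have := H _ (MZ (-1) _ Mz); rewrite scaleN1r qN; have := H _ Mz.
  by move=> *; apply/eqP; rewrite eq_le; lra.
have qx0 : d <= q x0.
  have := qW (- x0) 0 1 M0 ler01.
  by rewrite add0r ofreal1 scale1r addNr rnorm0 qN; lra.
(* The [K]-linear functional with real part [q]; over the reals [imunit] is 0 and [f] reduces to
   [q]. *)
pose f x : K := ofreal k (q x) - imunit k * ofreal k (q (imunit k *: x)).
have fre x : realpart (f x) = q x.
  by rewrite realpartB ofrealK realpart_imunit subr0.
have qi0 : q 0 = 0 by have := qD 0 0; rewrite addr0; lra.
have fD x y : f (x + y) = f x + f y.
  by rewrite /f scalerDr !qD !ofrealD mulrDr opprD addrACA.
have fr r x : f (ofreal k r *: x) = ofreal k r * f x.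
  by rewrite /f scalerA (mulrC (imunit k) (ofreal k r)) -scalerA !qZ !ofrealM
    mulrBr [in RHS]mulrCA.
have fi x : f (imunit k *: x) = imunit k * f x.
  have [i0|ii] := imunitP rT k.
    by rewrite /f i0 !scale0r qi0 ofreal0 !mul0r subr0.
  by rewrite /f scalerA ii scaleN1r qN ofrealN mulrN opprK mulrBr mulrA ii
    mulN1r opprK addrC.
have fN x : f (- x) = - f x.
  by have := fr (-1) x; rewrite ofrealN ofreal1 scaleN1r mulN1r.
have fZ a x : f (a *: x) = a * f x.
  rewrite [in LHS](scalarE a) scalerBl fD fN fr -scalerA fi fr mulrA -mulrBl.
  by rewrite -scalarE.
have flin : linear (f : E -> K^o) by move=> a x y; rewrite fD fZ.
have fn x : rnorm (f x : K^o) <= 1 * rnorm x.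
  rewrite mul1r; have [->|f0] := eqVneq (f x) 0;
    first by rewrite rnorm0 rnorm_ge0.
  (* Multiplying [x] by the unimodular scalar |f(x)| / f(x) makes the value of [f] real and
     nonnegative, hence equal to that of [q]. *)
  have -> : rnorm (f x : K^o) = q ((`|f x| / f x) *: x) by rewrite -fre fZ
    divfK.
  rewrite (le_trans (qn _))// rnormZ.
  rewrite [X in X * _](_ : _ = 1) ?mul1r// /rnorm normrM normfV normr_id divff
    ?normr_eq0//.
  by rewrite -(ofreal1 rT k) ofrealK.
have [psi psiE] := bounded_linear_blin flin fn.
exists psi; split=> [x|z Mz|].
- by rewrite psiE (le_trans (fn x)) ?mul1r.
- by rewrite psiE /f !qM ?ofreal0 ?mulr0 ?subr0//; exact: MZ.
- by rewrite psiE (le_trans qx0)// -fre realpart_le_norm.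
Qed.

End sublinear.

(** * Unconditional convergence *)

Section block_permutation.
Variable f : nat -> seq nat.
Hypothesis f_uniq : forall n, uniq (f n).
Hypothesis f_ge : forall n i, i \in f n -> (n <= i)%N.

(** It exceeds [size l] and every entry of the block, so [extend l] lists a strictly longer initial
    segment. *)
Let bound (l : seq nat) := maxn (size l).+1 (\max_(i <- f (size l)) i.+1).

(* [l] lists an initial segment of [nat];
  append the block [f (size l)], then the
   indices skipped by that block. *)
Let extend (l : seq nat) := l ++ f (size l) ++
  [seq i <- iota (size l) (bound l - size l) | i \notin f (size l)].

Let prefix_list n := iter n extend [::].

Let prefix_list_perm n : perm_eq (prefix_list n)
  (iota 0 (size (prefix_list n))).
Proof.
elim: n => // n; rewrite /prefix_list iterS.
set l := iter n extend _ => IH.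
have lE i : (i \in l) = (i < size l)%N by rewrite (perm_mem IH) mem_iota.
have sb : (size l < bound l)%N by rewrite /bound leq_maxl.
have fb i : i \in f (size l) -> (i < bound l)%N.
  move=> il; rewrite /bound leq_max; apply/orP; right.
  by rewrite (big_rem i)//= leq_max leqnn.
have peq : perm_eq (extend l) (iota 0 (bound l)).
  apply: uniq_perm; [|exact: iota_uniq|].
    rewrite !cat_uniq (perm_uniq IH) iota_uniq f_uniq filter_uniq ?iota_uniq//=
      andbT.
    apply/andP; split.
      rewrite has_cat; apply/norP; split; apply/hasPn => i.
        by move=> /f_ge h; apply/negP => il; have : i \in l by [];
          rewrite lE ltnNge h.
      rewrite mem_filter mem_iota => /and3P[_ h _]; apply/negP => il.
      by have : i \in l by []; rewrite lE ltnNge h.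
    by apply/hasPn => i; rewrite mem_filter => /andP[].
  move=> i; rewrite !mem_cat mem_filter !mem_iota lE add0n leq0n /=
    subnKC ?(ltnW sb)//.
  have [il|il] /= := ltnP i (size l); first by rewrite (ltn_trans il sb).
  by have [/fb|] /= := boolP (i \in f (size l)).
by rewrite (perm_size peq) size_iota.
Qed.

Let mem_prefix_list n i : (i \in prefix_list n) = (i < size (prefix_list n))%N.
Proof. by rewrite (perm_mem (prefix_list_perm n)) mem_iota. Qed.

Let prefix_list_uniq n : uniq (prefix_list n).
Proof. by rewrite (perm_uniq (prefix_list_perm n)) iota_uniq. Qed.

Let size_prefix_list n : (n <= size (prefix_list n))%N.
Proof.
elim: n => // n IH; rewrite (leq_ltn_trans IH)//.
have : size (prefix_list n) \in prefix_list n.+1;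
  last by rewrite mem_prefix_list.
rewrite /prefix_list iterS -/(prefix_list n) /extend !mem_cat mem_filter
  mem_iota.
rewrite leqnn /= subnKC; last by rewrite ltnW// leq_max ltnSn.
rewrite /bound leq_max ltnSn /= andbT.
by case: (_ \in f _); rewrite ?orbT.
Qed.

Let prefix_list_le m n : (m <= n)%N -> exists t, prefix_list n =
  prefix_list m ++ t.
Proof.
move=> /subnKC <-; elim: (n - m)%N => [|d [t IH]].
  by exists [::]; rewrite addn0 cats0.
rewrite addnS /prefix_list iterS -/(prefix_list (m + d)) {1}/extend IH -catA.
by eexists.
Qed.

(** The common limit of the prefix lists: list [i.+1] has more than [i] entries and later lists
    extend it, so the default 0 is never read. *)
Let perm i := nth 0%N (prefix_list i.+1) i.

Let permE n i : (i < size (prefix_list n))%N -> perm i =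
  nth 0%N (prefix_list n) i.
Proof.
move=> ni; rewrite /perm; have [h|/ltnW h] := leqP i.+1 n.
  by have [t ->] := prefix_list_le h; rewrite nth_cat size_prefix_list.
by have [t ->] := prefix_list_le h; rewrite nth_cat ni.
Qed.

Let perm_bij : bijective perm.
Proof.
exists (fun j => index j (prefix_list j.+1)) => [i|j].
  set j := perm i; pose n := maxn i.+1 j.+1.
  have [t nt] := prefix_list_le (leq_maxr i.+1 j.+1).
  have jn : j \in prefix_list j.+1 by rewrite mem_prefix_list size_prefix_list.
  have := index_cat j (prefix_list j.+1) t; rewrite jn -nt => <-.
  have iN : (i < size (prefix_list (maxn i.+1 j.+1)))%N.
    by rewrite (leq_trans (leq_maxl i.+1 j.+1)).
  by rewrite [j in index j](permE iN) index_uniq.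
have jn : j \in prefix_list j.+1 by rewrite mem_prefix_list size_prefix_list.
by rewrite (@permE j.+1) ?index_mem// nth_index.
Qed.

Lemma block_permutation : exists2 s : nat -> nat, bijective s &
  forall N, exists2 m, (N <= m)%N &
    [seq s i | i <- iota m (size (f m))] = f m.
Proof.
(* Stage N appends the block [f m] right after the first [m = size (prefix_list N)] entries. *)
exists perm => // N; exists (size (prefix_list N)) => //.
set m := size _; apply: (@eq_from_nth _ 0%N);
  first by rewrite size_map size_iota.
move=> i; rewrite size_map size_iota => im.
rewrite (nth_map 0%N) ?size_iota// nth_iota//.
have E : prefix_list N.+1 = prefix_list N ++ f m ++
  [seq i <- iota m (bound (prefix_list N) - m) | i \notin f m] by [].
rewrite (@permE N.+1) E; last by rewrite !size_cat -/m; lia.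
by rewrite nth_cat -/m ltnNge leq_addr /= addKn nth_cat im.
Qed.

End block_permutation.

Section unordered.
Variables (rT : realType) (k : scalar_kind).
Local Notation K := (scalar_field rT k).

Definition unordered_cauchy (V : normedModType K) (u : nat -> V) :=
  forall e : rT, 0 < e -> exists n, forall s : seq nat, uniq s ->
    (forall i, i \in s -> (n <= i)%N) -> rnorm (\sum_(i <- s) u i) < e.

(** If the criterion fails at e, there are finite blocks arbitrarily far out whose sums have norm at
    least e. A permutation along which such blocks occur consecutively infinitely often contradicts
    the convergence of the permuted series. *)
Lemma permuted_series_unordered_cauchy (V : normedModType K) (u : nat -> V) :
  (forall s : nat -> nat, bijective s -> cvgn (series (u \o s))) ->
  unordered_cauchy u.
Proof.
move=> H e e0; apply: contrapT => nH.
have Hf n : exists s : seq nat, [/\ uniq s, forall i, i \in s -> (n <= i)%N &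
    e <= rnorm (\sum_(i <- s) u i)].
  apply: contrapT => nHf; apply: nH; exists n => s us sn.
  by rewrite ltNge; apply/negP => es; apply: nHf; exists s.
have [f fP] := choice Hf.
have [|n i|s sbij sP] := @block_permutation f; [by move=> n; case: (fP n)| |].
  by case: (fP n) => _ + _; apply.
have /cvg_ex[l /cvg_rnormP] := H s sbij.
move=> /(_ (e / 2) ltac:(lra))[N NP].
have [m Nm sm] := sP N.
have := NP _ Nm; have := NP _ (leq_trans Nm (leq_addr (size (f m)) m)).
have -> : series (u \o s) (m + size (f m))%N =
    series (u \o s) m + \sum_(i <- f m) u i.
  rewrite -[in \sum_(_ <- _) _]sm big_map /series /=
    (@big_cat_nat _ _ _ m) ?leq_addr//=.
  by rewrite -{2}(addn0 m) [in X in _ + X = _]/index_iota addn0 addKn.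
have [_ _] := fP m.
set x := \sum_(i <- _) _; set y := series _ _.
have := rnormB (y + x - l) (y - l).
rewrite opprB addrA subrK addrAC subrr add0r; lra.
Qed.

End unordered.

(** * Almost disjoint families *)

Definition unbounded (A : set nat) := forall n, exists2 i, (n <= i)%N & A i.

Lemma unbounded_ge (A : set nat) N : unbounded A ->
  unbounded (A `&` [set i | (N <= i)%N]).
Proof.
move=> uA n; have [i + Ai] := uA (maxn N n).
by rewrite geq_max => /andP[Ni ni]; exists i.
Qed.

Lemma unbounded_lb (rT : realType) (V : Type) (u : nat -> V) (nu : V -> rT) :
  ~ (forall e : rT, 0 < e -> exists N, forall i, (N <= i)%N -> nu (u i) < e) ->
  exists2 e : rT, 0 < e & unbounded [set i | e <= nu (u i)].
Proof.
move=> H; apply: contrapT => nH; apply: H => e e0; apply: contrapT => H.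
apply: nH; exists e => // N; apply: contrapT => nH; apply: H; exists N => i Ni.
by rewrite ltNge; apply/negP => ei; apply: nH; exists i.
Qed.

Lemma injective_unbounded (h : nat -> nat) : injective h -> unbounded (range h).
Proof.
move=> hinj n; apply: contrapT => H.
have hn i : (h i < n)%N.
  by rewrite ltnNge; apply/negP => nh; apply: H; exists (h i) => //; exists i.
have := @uniq_leq_size _ (map h (iota 0 n.+1)) (iota 0 n).
rewrite map_inj_uniq// iota_uniq size_map !size_iota ltnn => /(_ isT).
suff H' : {subset map h (iota 0 n.+1) <= iota 0 n} by move=> /(_ H').
by move=> _ /mapP[i _ ->]; rewrite mem_iota /= add0n.
Qed.

Lemma unbounded_enum (A : set nat) : unbounded A ->
  exists2 h : nat -> nat, injective h & forall n, A (h n).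
Proof.
move=> /(_ _)/cid2-/all_sig2[g gn Ag].
pose h := fix h n := if n is m.+1 then g (h m).+1 else g 0%N.
have hmono : {homo h : m n / (m < n)%N}.
  by apply: homo_ltn => [m n p|n]; [exact: ltn_trans|exact: gn].
exists h => [m n hmn|[|n]]; [|exact: Ag..].
by have [/hmono|/hmono|] := ltngtP m n => //; rewrite hmn ltnn.
Qed.

(** The nodes of the binary tree along [x], that is its finite prefixes, coded as natural
    numbers. *)
Definition branch (x : nat -> bool) : set nat :=
  range (fun n => pickle (mkseq x n)).

(** A common node is a common prefix, so its length is at most any position where the two sequences
    differ. *)
Lemma branch_almost_disjoint x y : x <> y ->
  exists n, branch x `&` branch y `<=` `I_n.
Proof.
move=> xy; have [p xyp] : exists p, x p <> y p.
  by apply: contrapT => H; apply/xy/funext => p; apply: contrapT => ?; apply: H;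
    exists p.
exists (\max_(n < p.+1) (pickle (mkseq x n)).+1) => _
  [[n _ <-] [m _ /esym/(pcan_inj pickleK) e]].
have nm : n = m by move: (congr1 size e); rewrite !size_mkseq.
have np : (n < p.+1)%N.
  rewrite ltnS leqNgt; apply/negP => pn; apply: xyp.
  by have := congr1 (fun s => nth true s p) e; rewrite -nm !nth_mkseq.
exact: (@leq_bigmax _ (fun i : 'I_p.+1 => (pickle (mkseq x i)).+1)
  (Ordinal np)).
Qed.

Lemma uncountable_nat_bool : ~ countable [set: nat -> bool].
Proof.
move=> /countable_injP[f finj].
pose d n := ~~ `[< exists2 x, f x = n & x n >].
have [dfd|dfd] := boolP (d (f d)); have := dfd.
  by rewrite {1}/d => /asboolPn; apply; exists d.
rewrite {1}/d negbK => /asboolP[x fx xd]; move/negP : dfd; apply.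
have xe : x = d by apply: finj; rewrite ?inE.
by move: xd; rewrite xe.
Qed.

Section null_branch.
Variables (rT : realType) (h : nat -> nat).
Hypothesis h_inj : injective h.

Lemma null_bounded_set (Lam : set nat -> rT) :
  (forall A B, A `&` B = set0 -> Lam (A `|` B) = Lam A + Lam B) ->
  (forall i, Lam [set i] = 0) -> forall n A, A `<=` `I_n -> Lam A = 0.
Proof.
move=> LamU Lam1; elim=> [A|n IH A An].
  rewrite II0 subset0 => ->; have := LamU set0 set0;
    rewrite set0I setU0 => /(_ erefl); lra.
have IHn : Lam (A `\ n) = 0.
  apply: IH => i [Ai /= ni]; have := An _ Ai; rewrite /= ltnS leq_eqVlt.
  by case/orP => // /eqP.
have [An'|nAn] := pselect (A n); last first.
  by rewrite -IHn; congr Lam; apply/seteqP; split=> [i Ai|i []//];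
    split=> // iN; apply: nAn; rewrite -iN.
have -> : A = A `\ n `|` [set n].
  apply/seteqP; split=> [i Ai|i [[]|->]//].
  by have [->|/eqP ni] := eqVneq i n; [right|left; split].
rewrite LamU ?IHn ?Lam1 ?addr0//.
by apply/seteqP; split=> i // -[[]].
Qed.

(** Overlaps of distinct branches are finite, hence null, so removing them makes branches disjoint
    without changing their values. Infinitely many branches of value at least [d] would then give
    unions of value at least n d for every n. *)
Lemma finite_large_branches (Lam : set nat -> rT) (C d : rT) : 0 < d ->
  (forall A B, A `&` B = set0 -> Lam (A `|` B) = Lam A + Lam B) ->
  (forall i, Lam [set i] = 0) -> (forall A, Lam A <= C) ->
  finite_set [set x | d <= Lam (h @` branch x)].
Proof.
move=> d0 LamU Lam1 LamC; apply: contrapT => /infiniteP/pcard_leP[g].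
have ginj m n : g m = g n -> m = n by apply: inj; rewrite inE.
have gd n : d <= Lam (h @` branch (g n)) by apply: (@funS _ _ _ _ g n).
pose U n := [set i | exists2 m, (m < n)%N & (h @` branch (g m)) i].
have branchU m n : (m <= n)%N -> exists N, h @` branch (g n) `&` U m `<=` `I_N.
  elim: m => [|m IH] mn; first by exists 0%N => i [_ []].
  have [N NP] := IH (ltnW mn).
  have [|N' N'P] := @branch_almost_disjoint (g n) (g m).
    by move=> /ginj nm; rewrite nm ltnn in mn.
  exists (maxn N (\max_(i < N') (h i).+1)) => i [Bi [p]];
    rewrite ltnS leq_eqVlt.
  rewrite /= leq_max => /predU1P[->{p} Bm|pm Bp]; last first.
    by apply/orP; left; apply: NP; split => //; exists p.
  apply/orP; right; case: Bi Bm => j Bj <-{i} [j' Bj' /h_inj jj'].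
  have jN' : (j < N')%N by apply: N'P; split=> //; rewrite -jj'.
  exact: (@leq_bigmax _ (fun i : 'I_N' => (h i).+1) (Ordinal jN')).
have LamUn n : n%:R * d <= Lam (U n).
  elim: n => [|n IH].
    by rewrite mul0r (@null_bounded_set _ LamU Lam1 0%N)// => i [].
  pose B := h @` branch (g n).
  have -> : U n.+1 = U n `|` (B `\` U n).
    apply/seteqP; split=> i.
      move=> [m]; rewrite ltnS leq_eqVlt => /predU1P[->|mn] Bi; last by left;
        exists m.
      by have [|] := pselect (U n i); [left|right].
    by move=> [[m /ltnW mn Bi]|[Bi _]]; [exists m|exists n].
  rewrite LamU; last by apply/seteqP; split=> i // -[? []].
  have [N NP] := branchU n n (leqnn n).
  have := gd n; rewrite -/B.
  have {1}-> : B = B `\` U n `|` B `&` U n by rewrite setUC setUIDK.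
  rewrite LamU; last by apply/seteqP; split=> i // -[[_ +] [_]].
  rewrite (null_bounded_set LamU Lam1 NP) addr0 -natr1 mulrDl mul1r.
  by move=> ?; rewrite lerD.
have := LamUn (Num.truncn (`|C| / d)).+1; rewrite leNgt => /negP; apply.
rewrite (le_lt_trans (LamC _))// -ltr_pdivrMr//.
by rewrite (le_lt_trans _ (truncnS_gt _))// ler_wpM2r ?ler_norm// invr_ge0 ltW.
Qed.

End null_branch.

(* A bounded additive function charges only countably many members of an
   almost disjoint family, and the branches of the binary tree form an
   uncountable one. *)
Lemma almost_disjoint_null_set (rT : realType) (J : countType) (I : set nat)
    (Lam : J -> set nat -> rT) : unbounded I ->
  (forall j A B, A `&` B = set0 -> Lam j (A `|` B) = Lam j A + Lam j B) ->
  (forall j i, Lam j [set i] = 0) ->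
  (forall j, exists C, forall A, `|Lam j A| <= C) ->
  exists M, [/\ M `<=` I, unbounded M & forall j, Lam j M = 0].
Proof.
move=> /unbounded_enum[h hinj hI] LamU Lam1 LamC; apply: contrapT => H.
apply: uncountable_nat_bool.
(* The index consists of a set function, a sign and a threshold 1/(p+1). If every branch is charged
   by some [Lam j], these finite sets cover all branches. *)
pose X (p : J * bool * nat) :=
  [set x | p.2.+1%:R^-1 <= (-1) ^+ p.1.2 * Lam p.1.1 (h @` branch x)].
have -> : [set: nat -> bool] = \bigcup_p X p.
  apply/seteqP; split=> // x _.
  have [j Lj] : exists j, Lam j (h @` branch x) != 0.
    apply: contrapT => nL; apply: H; exists (h @` branch x); split.
    - by move=> _ [i _ <-].
    - rewrite /branch image_comp; apply: injective_unbounded => m n /hinj.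
      by move=> /(pcan_inj pickleK)/(congr1 size); rewrite !size_mkseq.
    - by move=> j; apply/eqP; apply: contrapT => /negP Lj; apply: nL; exists j.
  exists (j, Lam j (h @` branch x) < 0, Num.truncn `|Lam j (h @` branch x)|^-1)
    => //.
  rewrite /X /= -normrEsign -[leRHS]invrK lef_pV2 ?posrE ?invr_gt0 ?normr_gt0//.
  exact/ltW/truncnS_gt.
apply: bigcup_countable => // -[[j b] p] _; apply: finite_set_countable.
have [C CP] := LamC j.
apply: (finite_large_branches hinj (Lam := fun A => (-1) ^+ b * Lam j A)
  (C := C)).
- by rewrite invr_gt0.
- by move=> A B AB; rewrite LamU// mulrDr.
- by move=> i; rewrite Lam1 mulr0.
- by move=> A; rewrite (le_trans (ler_norm _))//
  normrM normrX normrN1 expr1n mul1r.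
Qed.

(** * Basic sequences *)

Section closure.
Variables (rT : realType) (k : scalar_kind).
Local Notation K := (scalar_field rT k).
Variable V : normedModType K.

Lemma closure_rnormP (A : set V) v : closure A v <->
  forall e : rT, 0 < e -> exists2 w, A w & rnorm (v - w) < e.
Proof.
split=> [Av e e0|H B /nbhs_rnormP[e e0 eB]].
  have [|w [Aw vw]] := Av [set w | rnorm (w - v) < e].
    by apply/nbhs_rnormP; exists e.
  by exists w => //; rewrite rdistC.
by have [w Aw vw] := H _ e0; exists w; split=> //; apply: eB; rewrite rdistC.
Qed.

Lemma subspace_closure (A : set V) : subspace A -> subspace (closure A).
Proof.
move=> [A0 AD AZ]; split.
- exact: subset_closure.
- move=> v w /closure_rnormP Av /closure_rnormP Aw;
  apply/closure_rnormP => e e0.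
  have e20 : 0 < e / 2 by lra.
  have [v' Av' vv'] := Av _ e20; have [w' Aw' ww'] := Aw _ e20.
  exists (v' + w'); first exact: AD.
  by rewrite opprD addrACA (le_lt_trans (rnormD _ _))// (splitr e) ltrD.
- move=> a v /closure_rnormP Av; apply/closure_rnormP => e e0.
  have a0 : 0 < rnorm (a : K^o) + 1 by rewrite ltr_wpDl ?rnorm_ge0.
  have [|v' Av' vv'] := Av (e / (rnorm (a : K^o) + 1));
    first by rewrite divr_gt0.
  exists (a *: v'); first exact: AZ.
  rewrite -scalerBr rnormZ; move: vv'; rewrite ltr_pdivlMr// mulrC;
    apply: le_lt_trans.
  by rewrite ler_wpM2r ?rnorm_ge0// lerDl.
Qed.

Lemma rclosed_closure (A : set V) : rclosed (closure A).
Proof.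
move=> v H; apply/closure_rnormP => e e0; have e20 : 0 < e / 2 by lra.
have [w /closure_rnormP/(_ _ e20)[w' Aw' ww'] vw] := H _ e20.
by exists w' => //; rewrite (le_lt_trans (rdistD w _ _))// (splitr e) ltrD.
Qed.

(** The linear span of the [x i] with [i] outside [B]. Eventually constant partial sums allow
    coefficient sequences to be combined termwise. *)
Definition finite_span (x : nat -> V) (B : set nat) : set V :=
  [set z | exists b : nat -> K, (forall i, B i -> b i = 0) /\
     exists N, forall n, (N <= n)%N -> series (fun i => b i *: x i) n = z].

Lemma series_linear (a : K) (b c : nat -> K) (x : nat -> V) n :
  series (fun i => (a * b i + c i) *: x i) n =
  a *: series (fun i => b i *: x i) n + series (fun i => c i *: x i) n.
Proof.
rewrite /series /= scaler_sumr -big_split; apply: eq_bigr => i _.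
by rewrite scalerDl scalerA.
Qed.

Lemma subspace_finite_span x B : subspace (finite_span x B).
Proof.
have lin a v w : finite_span x B v -> finite_span x B w ->
  finite_span x B (a *: v + w).
  move=> [b [bB [N bN]]] [c [cB [N' cN']]]; exists (fun i => a * b i + c i);
    split.
    by move=> i Bi; rewrite bB// cB// mulr0 addr0.
  exists (maxn N N') => n; rewrite geq_max => /andP[Nn N'n].
  by rewrite series_linear bN// cN'.
have z : finite_span x B 0.
  exists (fun=> 0); split=> //; exists 0%N => n _.
  by rewrite /series /= big1// => i _; rewrite scale0r.
split=> // [v w Bv Bw|a v Bv]; first by rewrite -[v]scale1r; exact: lin.
by rewrite -[_ *: _]addr0; exact: lin.
Qed.

Lemma finite_span0E x : finite_span x set0 =
  [set v | exists N (a : nat -> K), v = \sum_(i < N) a i *: x i].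
Proof.
apply/seteqP; split=> [v [b [_ [N bN]]]|v [N [a ->]]].
  by exists N, b; rewrite -(bN N)// /series /= big_mkord.
exists (fun i => if (i < N)%N then a i else 0); split=> //; exists N => n Nn.
rewrite /series /= -(subnKC Nn) (@big_cat_nat _ _ _ N) ?leq_addr//=.
rewrite [X in _ + X]big1_seq ?addr0; last first.
  by move=> i /andP[_]; rewrite mem_index_iota => /andP[/leq_gtF -> _];
    rewrite scale0r.
by rewrite big_mkord; apply: eq_bigr => i _; rewrite ltn_ord.
Qed.

Lemma finite_span_mem x B i : ~ B i -> finite_span x B (x i).
Proof.
move=> nBi; exists (fun j => (j == i)%:R); split.
  by move=> j Bj; case: eqP => // ji; case: nBi; rewrite -ji.
exists i.+1 => n ni; rewrite /series /=
  (bigD1_seq i) ?iota_uniq ?mem_index_iota//=.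
by rewrite eqxx scale1r big1 ?addr0// => j /negbTE ->; rewrite scale0r.
Qed.

Lemma subspace_closed_span x : @subspace rT k V (closed_span x).
Proof. by rewrite /closed_span -finite_span0E;
  apply/subspace_closure/subspace_finite_span. Qed.

Lemma cvg_rnorm_bounded (u : nat -> V) (l : V) : u @ \oo --> l ->
  exists c, forall n, rnorm (u n) <= c.
Proof.
move=> /cvg_rnormP/(_ 1 ltr01)[N uN].
exists (rnorm l + 1 + \sum_(i < N) rnorm (u i)) => n.
have s0 : 0 <= \sum_(i < N) rnorm (u i) by apply: sumr_ge0 => i _;
  exact: rnorm_ge0.
have [nN|/uN] := ltnP n N; last first.
  by have := rdistD l (u n) 0; rewrite !subr0; lra.
rewrite (bigD1 (Ordinal nN))//=.
have : 0 <= \sum_(i < N | i != Ordinal nN) rnorm (u i).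
  by apply: sumr_ge0 => i _; exact: rnorm_ge0.
have := rnorm_ge0 l; lra.
Qed.

End closure.

Section basis.
Variables (rT : realType) (k : scalar_kind).
Local Notation K := (scalar_field rT k).
Variables (F : completeNormedModType K) (f : nat -> F).
Hypothesis f_basis : @schauder_basis_of rT k F (closed_span f) f.

Let M : set F := @closed_span rT k F f.

Lemma basis_expansion v : M v -> exists a : nat -> K,
  series (fun i => a i *: f i) @ \oo --> (v : F).
Proof. by case: f_basis => _ /[apply] -[a [aP _]]; exists a. Qed.

Lemma basis_expansion_unique v (a b : nat -> K) : M v ->
  series (fun i => a i *: f i) @ \oo --> v ->
  series (fun i => b i *: f i) @ \oo --> v -> a = b.
Proof. by case: f_basis => _ /[apply] -[c [_ cu]] /cu <- /cu <-. Qed.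

(** Otherwise the i-th coefficient in an expansion of 0 would be arbitrary. *)
Lemma basis_neq0 i : f i != 0.
Proof.
apply/eqP => fi0; have M0 : M 0 by have [] := subspace_closed_span f.
have H (b : nat -> K) : (forall j, j != i -> b j = 0) ->
    series (fun j => b j *: f j) @ \oo --> (0 : F).
  move=> bi; rewrite (_ : series _ = fun=> 0); first exact: cvg_cst.
  apply/funext => n; rewrite /series /= big1// => j _.
  by have [->|/bi ->] := eqVneq j i; rewrite ?fi0 ?scaler0// scale0r.
have := basis_expansion_unique M0 (H (fun=> 0) ltac:(by []))
  (H (fun j => (j == i)%:R) _).
move=> /(_ ltac:(by move=> j /negbTE ->))/(congr1 (@^~ i));
  rewrite eqxx => /eqP.
by rewrite eq_sym oner_eq0.
Qed.

(* A functional that does not vanish at [f i] reads the scalar off the limit. *)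
Lemma multiples_closed i (y : nat -> F) l : (forall m, exists a, y m = a *: f i)
  ->
  y @ \oo --> l -> exists a, l = a *: f i.
Proof.
move=> yf yl; have f0 := basis_neq0 i.
have [||psi [psin _ psif]] := @separating_functional _ _ F [set 0] (f i)
  (rnorm (f i)).
- split=> //= [_ _ -> ->|a _ ->]; [exact: addr0|exact: scaler0].
- by move=> _ ->; rewrite subr0.
have pf0 : psi (f i) != 0 :> K^o.
  by rewrite -rnorm_gt0 (lt_le_trans _ psif)// rnorm_gt0.
(* The defect [d] vanishes on the multiples of [f i] and is Lipschitz, so it vanishes at the
   limit. *)
pose d y := (psi y / psi (f i) : K) *: f i - y.
exists (psi l / psi (f i)); apply/eqP; rewrite eq_sym -subr_eq0 -/(d l);
  apply/eqP.
apply: (@cvg_rnorm_unique _ _ _ (d \o y)).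
  apply: (@cvg_rnorm_linear _ _ _ _ d
    (rnorm ((psi (f i))^-1 : K^o) * rnorm (f i) + 1) _ _ _ yl).
  move=> v w; have -> : d v - d w = d (v - w).
    have pB : psi (v - w) = (psi v : K) - psi w by exact: linearB.
    by rewrite /d pB mulrBl scalerBl !opprB addrACA [RHS]addrACA; congr (_ + _);
      rewrite addrC.
  rewrite /d (le_trans (rnormB _ _))// mulrDl mul1r lerD2r// rnormZ mulrAC.
  rewrite ler_wpM2r ?rnorm_ge0//
    (rnormZ (psi (v - w) : K) ((psi (f i))^-1 : K^o)).
  by rewrite mulrC ler_wpM2l ?rnorm_ge0.
have -> : d \o y = fun=> 0; last exact: cvg_cst.
apply/funext => m /=; have [a ->] := yf m.
have pZ : psi (a *: f i) = a * psi (f i) :> K by exact: linearZ.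
by rewrite /d pZ -mulrA divff// mulr1 subrr.
Qed.

End basis.

(** * The basis constant and biorthogonal functionals *)

Section basis_constant.
Variables (rT : realType) (k : scalar_kind).
Local Notation K := (scalar_field rT k).
Variables (F : completeNormedModType K) (f : nat -> F).
Hypothesis f_basis : @schauder_basis_of rT k F (closed_span f) f.

Let M : set F := @closed_span rT k F f.
Let expansion (b : nat -> K) : nat -> F := series (fun i => b i *: f i).

Let expansionB (b c : nat -> K) n :
  expansion (fun i => b i - c i) n = expansion b n - expansion c n.
Proof.
rewrite -[- expansion c n]scaleN1r addrC /expansion -series_linear.
by congr (series _ n); apply/funext => i; rewrite mulN1r addrC.
Qed.

Let expansionZ (a : K) (b : nat -> K) n :
  expansion (fun i => a * b i) n = a *: expansion b n.
Proof.
by rewrite /expansion /series /= scaler_sumr; apply: eq_bigr => i _;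
  rewrite scalerA.
Qed.

(** The sublevel set of sup_n |P_n v|, with P_n the partial sum projections; Zabreiko's lemma is
    applied to this seminorm. *)
Let partial_sums_le (c : rT) : set F :=
  [set v | forall a, expansion a @ \oo --> v -> forall n,
    rnorm (expansion a n) <= c].

(** Countable subadditivity. For each n the n-th partial sums of the [w j] add up to some [s n].
    Consecutive [s n] differ by a multiple of [f n] and [s n] tends to [v], so by uniqueness they
    are the partial sums of [v]. *)
Let partial_sums_le_series c (w : nat -> F) v : (forall j, M (w j)) ->
  (forall j, partial_sums_le (c / 2 ^+ j) (w j)) -> series w @ \oo --> v ->
  partial_sums_le (2 * c) v.
Proof.
move=> Mw wc wv a av.
have [b bw] := choice (fun j => basis_expansion f_basis (Mw j)).
have [s sb] := choice
  (fun n => (exists2P _ _).1 (absolute_cvg (fun j => wc j _ (bw j) n))).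
have Mv : M v.
  apply: (@rclosed_cvg _ _ _ M _ _ _ _ wv) => [|n];
    first exact: rclosed_closure.
  by apply: (@subspace_sum _ _ _ M) => //; exact: subspace_closed_span.
(* One [m] serves all [n], since the bounds c/2^j do not depend on [n]; this justifies exchanging
   the two limits in [sv]. *)
have tail (e : rT) : 0 < e -> exists m, rnorm (series w m - v) < e /\
    forall n, rnorm (s n - series (fun j => expansion (b j) n) m) < e.
  move=> e0; have [m1 m1P] := geometric_small (2 * c) e0.
  have /cvg_rnormP/(_ _ e0)[m2 m2P] := wv.
  exists (maxn m1 m2); split; first by rewrite m2P// leq_maxr.
  by move=> n; rewrite (le_lt_trans ((sb n).2 _))// m1P// leq_maxl.
have partial m : (fun n => series (fun j => expansion (b j) n) m) @ \oo -->
  series w m.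
  elim: m => [|m IH].
    rewrite (_ : (fun n => _) = fun=> series w 0); first exact: cvg_cst.
    by apply/funext => n; rewrite /series /= !big_geq.
  rewrite seriesSr (_ : (fun n => _) =
    (fun n => series (fun j => expansion (b j) n) m) \+ expansion (b m)).
    by apply: cvgD => //; exact: bw.
  by apply/funext => n; rewrite seriesSr.
have sv : s @ \oo --> v.
  apply/cvg_rnormP => e e0; have e30 : 0 < e / 3 by lra.
  have [m [m1 m2]] := tail _ e30.
  have /cvg_rnormP/(_ _ e30)[N NP] := partial m; exists N => n /NP.
  have := rdistD (series (fun j => expansion (b j) n) m) (s n) v.
  have := rdistD (series w m) (series (fun j => expansion (b j) n) m) v.
  by have := m2 n; lra.
have step n : exists a : K, s n.+1 - s n = a *: f n.
  apply: (multiples_closed f_basis (y :=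
    series (fun j => expansion (b j) n.+1) \- series
      (fun j => expansion (b j) n))).
    move=> m; exists (\sum_(0 <= j < m) b j n).
    rewrite /series /= -sumrB scaler_suml; apply: eq_bigr => j _.
    by rewrite /expansion seriesSr addrAC subrr add0r.
  by apply: cvgB; [exact: (sb n.+1).1|exact: (sb n).1].
have [al alP] := choice step.
have s0 : s 0%N = 0.
  apply: (cvg_rnorm_unique (sb 0%N).1).
  rewrite (_ : series _ = fun=> 0); first exact: cvg_cst.
  by apply/funext => m; rewrite /series /= big1// => j _;
    rewrite /expansion /series /= big_geq.
have sE : s = expansion al.
  apply/funext; elim=> [|n IH];
    first by rewrite s0 /expansion /series /= big_geq.
  by rewrite /expansion seriesSr -/(expansion al n) -IH -alP addrC subrK.
have ala : al = a by apply: (basis_expansion_unique f_basis Mv _ av);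
  rewrite -/(expansion al) -sE.
move=> n; rewrite -ala -sE.
by have := (sb n).2 0%N; rewrite expr0 divr1 /series /= big_geq// subr0.
Qed.

(** Convergent expansions have bounded partial sums, so the seminorm is finite on the closed span
    and Zabreiko's lemma bounds it on the unit ball. *)
Lemma basis_constant : exists2 C : rT, 0 < C & forall (a : nat -> K) v,
  expansion a @ \oo --> v -> M v -> rnorm v <= 1 ->
  forall n, rnorm (expansion a n) <= C.
Proof.
have [|||||||C C0 CP] := @zabreiko _ _ F M partial_sums_le.
- exact: subspace_closed_span.
- exact: rclosed_closure.
- move=> v Mv; have [a av] := basis_expansion f_basis Mv.
  have [c cP] := cvg_rnorm_bounded av; exists c => b bv n.
  by rewrite (basis_expansion_unique f_basis Mv bv av); exact: cP.
- move=> c d v cd vc a av n; apply: le_trans cd; exact: (vc a av n).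
- move=> c d v w Mv Mw vc wd a avw n.
  have [av avP] := basis_expansion f_basis Mv.
  have [aw awP] := basis_expansion f_basis Mw.
  have -> : a = (fun i => av i - aw i).
    apply: (basis_expansion_unique f_basis _ avw).
      exact: subspaceB (subspace_closed_span f) _ _ _ _.
    rewrite -/(expansion _) (_ : expansion _ = expansion av \- expansion aw).
      exact: cvgB.
    by apply/funext => m; exact: expansionB.
  by rewrite expansionB (le_trans (rnormB _ _))// lerD ?vc ?wd.
- move=> c r v Mv r0 vc a arv n.
  have [av avP] := basis_expansion f_basis Mv.
  have -> : a = (fun i => ofreal k r * av i).
    apply: (basis_expansion_unique f_basis _ arv).
      by have [_ _] := subspace_closed_span f; apply.
    rewrite -/(expansion _)
      (_ : expansion _ = (fun n => ofreal k r *: expansion av n)).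
      exact: cvgZr.
    by apply/funext => m; exact: expansionZ.
  by rewrite expansionZ rnormZr gtr0_norm// ler_pM2l// vc.
- by move=> c w v; exact: partial_sums_le_series.
by exists C => // a v av Mv v1; exact: CP Mv v1 a av.
Qed.

(** Each [f i] has distance at least [D] from the span of the others, uniformly in [i]; normalized
    separating functionals then have norm at most 1/D. *)
Lemma biorthogonal_functionals (d : rT) : 0 < d ->
  (forall i, d <= rnorm (f i)) ->
  exists (r : nat -> dual F) (C : rT), (forall i j, r i (f j) = (i == j)%:R) /\
    forall i y, rnorm (r i y) <= C * rnorm y.
Proof.
move=> d0 fd; have [C C0 CP] := basis_constant.
(* If |f_i - z| < D, then (f_i - z)/D has norm at most 1, yet its i-th term has norm at least d/D =
   4C, although consecutive partial sums differ by at most 2C. *)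
pose D := d / (4 * C).
have D0 : 0 < D by rewrite divr_gt0// mulr_gt0.
have dist i z : finite_span f [set i] z -> D <= rnorm (f i - z).
  move=> [b [bi [N bN]]]; rewrite leNgt; apply/negP => H.
  pose t := D^-1; have t0 : 0 < t by rewrite invr_gt0.
  pose a j := ofreal k t * ((j == i)%:R - b j).
  have aE n : (maxn N i.+1 <= n)%N -> expansion a n = ofreal k t *: (f i - z).
    rewrite geq_max => /andP[Nn iN].
    rewrite /a expansionZ expansionB [expansion b n]bN//; congr (_ *: (_ - _)).
    rewrite /expansion /series /= (bigD1_seq i) ?iota_uniq ?mem_index_iota//=.
    by rewrite eqxx scale1r big1 ?addr0// => j /negbTE ->; rewrite scale0r.
  have av : expansion a @ \oo --> ofreal k t *: (f i - z).
    apply/cvg_rnormP => e e0; exists (maxn N i.+1) => n /aE ->.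
    by rewrite subrr rnorm0.
  have Mv : M (ofreal k t *: (f i - z)).
    have [_ _ MZ] := subspace_closed_span f; apply: MZ.
    apply: (subspaceB (subspace_closed_span f)).
      by case: f_basis => + _; apply.
    apply: subset_closure; rewrite -finite_span0E.
    by exists b; split=> //; exists N.
  have v1 : rnorm (ofreal k t *: (f i - z)) <= 1.
    by rewrite rnormZr gtr0_norm// /t ler_pdivrMl// mulr1 ltW.
  have := rnormB (expansion a i.+1) (expansion a i).
  rewrite {1}/expansion seriesSr -/(expansion a i) addrAC subrr add0r.
  rewrite /a eqxx bi// subr0 mulr1 rnormZr gtr0_norm//.
  rewrite leNgt => /negP; apply.
  have := CP _ _ av Mv v1 i; have := CP _ _ av Mv v1 i.+1.
  have : t * d <= t * rnorm (f i) by rewrite ler_pM2l.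
  have -> : t * d = 4 * C by rewrite /t /D invf_div divfK// gt_eqF.
  rewrite /a; lra.
have [psi psiP] := choice
  (fun i => separating_functional (subspace_finite_span f [set i]) (@dist i)).
have psi0 i : psi i (f i) != 0 :> K^o.
  by rewrite -rnorm_gt0; have [_ _ h] := psiP i; exact: lt_le_trans h.
exists (fun i => (psi i (f i))^-1 *: psi i), D^-1; split=> [i j|i y].
  rewrite blinZ; have [->|ij] := eqVneq i j; first exact: mulVf.
  have [_ h _] := psiP i; rewrite (h (f j)); first exact: scaler0.
  by apply: finite_span_mem => /= ji; rewrite ji eqxx in ij.
rewrite blinZ rnormZ; have [h _ h'] := psiP i.
apply: ler_pM; rewrite ?rnorm_ge0//.
have := rnormZ ((psi i (f i))^-1 : K) (psi i (f i) : K^o).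
rewrite (_ : _ *: _ = 1 :> K^o); last exact: mulVf.
rewrite -(ofreal1 rT k) rnorm_ofreal normr1 => e.
have p0 : 0 < rnorm (psi i (f i) : K^o) by rewrite rnorm_gt0.
rewrite -(ler_pM2r p0) -e mulrC ler_pdivlMr// mul1r.
exact: h'.
Qed.

End basis_constant.

(** * Subseries operators and polynomials *)

Section subseries.
Variables (rT : realType) (k : scalar_kind).
Local Notation K := (scalar_field rT k).
Variables (E F : completeNormedModType K) (phi : nat -> dual E) (f : nat -> F).
Hypothesis phi_f_cauchy : forall x, unordered_cauchy (fun i => phi i x *: f i).

Let S (s : seq nat) x : F := \sum_(i <- s) phi i x *: f i.

Let S_linear s : linear (S s).
Proof.
move=> a x y; rewrite /S scaler_sumr -big_split; apply: eq_bigr => i _ /=.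
by rewrite linearP scalerDl scalerA.
Qed.

Let S_lipschitz s x y : rnorm (S s x - S s y) <=
  (\sum_(i <- s) rnorm (phi i) * rnorm (f i)) * rnorm (x - y).
Proof.
have -> : S s x - S s y = S s (x - y).
  by rewrite -scaleN1r addrC -S_linear scaleN1r addrC.
rewrite mulr_suml (le_trans (rnorm_sum _ _ _))//; apply: ler_sum => i _.
by rewrite rnormZ mulrAC ler_wpM2r ?rnorm_ge0// blin_rnorm.
Qed.

(** Zabreiko's lemma for the supremum over finite index sets. It is finite at each [x]: indices
    below [n] contribute at most a fixed sum of norms, the others at most 1 by the Cauchy
    criterion. *)
Lemma finite_subsums_bounded : exists2 C : rT, 0 < C &
  forall s x, uniq s -> rnorm (\sum_(i <- s) phi i x *: f i) <= C * rnorm x.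
Proof.
pose Q (c : rT) := [set x | forall s, uniq s -> rnorm (S s x) <= c].
have [|||||||C C0 CP] := @zabreiko _ _ E setT Q.
- by [].
- by [].
- move=> x _; have [n nP] := phi_f_cauchy x ltr01.
  exists (\sum_(i < n) rnorm (phi i x *: f i) + 1) => s us.
  rewrite /S (bigID (fun i => (i < n)%N))/= (le_trans (rnormD _ _))// lerD//;
    last first.
    rewrite ltW// -big_filter nP ?filter_uniq// => i.
    by rewrite mem_filter -leqNgt => /andP[].
  rewrite (le_trans (rnorm_sum _ _ _))// -[leLHS]big_filter.
  rewrite (perm_big [seq i <- iota 0 n | i \in s]); last first.
    apply: uniq_perm; rewrite ?filter_uniq ?iota_uniq// => i.
    by rewrite !mem_filter mem_iota add0n leq0n /= andbC.
  rewrite big_filter big_mkcond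
    -(big_mkord xpredT (fun i => rnorm (phi i x *: f i))).
  by rewrite /index_iota subn0; apply: ler_sum => i _; case: ifP => // _;
    exact: rnorm_ge0.
- by move=> c d x cd xc s us; apply: le_trans cd; exact: xc.
- move=> c d x y _ _ xc yd s us.
  have -> : S s (x - y) = S s x - S s y.
    by rewrite -scaleN1r addrC S_linear scaleN1r addrC.
  by rewrite (le_trans (rnormB _ _))// lerD ?xc ?yd.
- move=> c r x _ r0 xc s us.
  have -> : S s (ofreal k r *: x) = ofreal k r *: S s x.
    by rewrite /S scaler_sumr; apply: eq_bigr => i _; rewrite linearZ scalerA.
  by rewrite rnormZr gtr0_norm// ler_pM2l// xc.
- move=> c w x _ wc wx s us.
  have [l wl lb] := absolute_cvg (fun j => wc j s us).
  have <- : l = S s x.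
    apply: (cvg_rnorm_unique wl).
    rewrite (_ : series _ = S s \o series w).
      exact: (cvg_rnorm_linear (S_lipschitz s) wx).
    apply/funext => n /=; rewrite /S /series /= exchange_big;
      apply: eq_bigr => i _ /=.
    by rewrite linear_sum scaler_suml.
  by have := lb 0%N; rewrite expr0 divr1 /series /= big_geq// subr0.
exists C => // s x us; have [->|x0] := eqVneq x 0.
  by rewrite rnorm0 mulr0 big1 ?rnorm0// => i _; rewrite linear0 scale0r.
have nx0 : 0 < rnorm x by rewrite rnorm_gt0.
have := CP (ofreal k (rnorm x)^-1 *: x) Logic.I.
rewrite rnormZr ger0_norm ?invr_ge0 ?rnorm_ge0// mulVf ?gt_eqF//
  => /(_ (lexx _) s us).
have -> : S s (ofreal k (rnorm x)^-1 *: x) = ofreal k (rnorm x)^-1 *: S s x.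
  by rewrite /S scaler_sumr; apply: eq_bigr => i _; rewrite linearZ scalerA.
by rewrite rnormZr ger0_norm ?invr_ge0 ?rnorm_ge0// ler_pdivrMl// mulrC.
Qed.

Let restriction (A : set nat) x i : F := if i \in A then phi i x *: f i else 0.

Let restrictionE A x m n : (m <= n)%N ->
  series (restriction A x) n - series (restriction A x) m =
  S [seq i <- iota m (n - m) | i \in A] x.
Proof.
by move=> mn; rewrite sub_series_geq// /S big_filter [RHS]big_mkcond.
Qed.

(** Subseries inherit the unordered Cauchy criterion and hence converge; the bound on finite sums
    passes to the limit, uniformly in [A]. *)
Lemma subseries_operators : exists (T : set nat -> blin E F) (C : rT),
  (forall A x, series (fun i => if i \in A then phi i x *: f i else 0) @ \oo -->
    T A x) /\
  forall A x, rnorm (T A x) <= C * rnorm x.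
Proof.
have [C C0 CP] := finite_subsums_bounded.
suff H A : exists T : blin E F,
  (forall x, series (restriction A x) @ \oo --> T x) /\
    forall x, rnorm (T x) <= C * rnorm x.
  have [T TP] := choice H; exists T, C; by split=> A;
    [exact: (TP A).1|exact: (TP A).2].
have /choice[T TP] x : exists l : F, series (restriction A x) @ \oo --> l.
  apply: rnorm_complete => e e0; have [n nP] := phi_f_cauchy x e0.
  exists n => m nm; rewrite restrictionE// nP ?filter_uniq ?iota_uniq// => i.
  by rewrite mem_filter mem_iota => /and3P[].
have TC x : rnorm (T x) <= C * rnorm x.
  rewrite -[T x]subr0; apply: (cvg_rnorm_le (TP x)); exists 0%N => m _.
  rewrite subr0 -[series _ m]subr0
    -[X in _ - X](_ : series (restriction A x) 0 = 0).
    by rewrite restrictionE// CP// filter_uniq// iota_uniq.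
  by rewrite /series /= big_geq.
have Tlin : linear T.
  move=> a x y; apply: (cvg_rnorm_unique (TP _)).
  rewrite (_ : series _ = (fun n => a *: series (restriction A x) n) \+
    series (restriction A y)); first by apply: cvgD => //; exact: cvgZr.
  apply/funext => n; rewrite /series /= scaler_sumr -big_split;
    apply: eq_bigr => i _.
  rewrite /restriction /=; case: ifP => _; last by rewrite scaler0 addr0.
  by rewrite linearP scalerDl scalerA.
have [T' T'E] := bounded_linear_blin Tlin TC.
by exists T'; split=> x; rewrite T'E.
Qed.

End subseries.

(** * Polynomials obtained as a power of a functional times an operator *)

Section weighted_operator.
Variables (rT : realType) (k : scalar_kind).
Local Notation K := (scalar_field rT k).
Variables (m : nat) (E F : normedModType K) (phi0 : dual E) (T : blin E F).

Lemma weighted_operator_subproof :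
  (fun x => (phi0 x : K) ^+ m *: T x) \in @continuous_polynomial rT k m.+1 E F.
Proof.
apply/asboolP; split; last first.
  move=> x; apply: cvgZ; last exact: blin_continuous.
  elim: m => [|p IH]; first by rewrite expr0; exact: cvg_cst.
  rewrite exprS (_ : (fun _ => _) =
    (fun x => (phi0 x : K) * (phi0 x : K) ^+ p)).
    by apply: cvgM => //; exact: blin_continuous.
  by apply/funext => y; rewrite exprS.
(* The multilinear form puts [phi0] in the first [m] slots and [T] in the last. *)
exists (fun x => (\prod_(j < m.+1 | j != ord_max) (phi0 (x j) : K)) *: T
  (x ord_max)).
  move=> x i a u v; have [->|im] := eqVneq i ord_max.
    rewrite !dfwithin linearP scalerDr !scalerA mulrC.
    have E1 w : \prod_(j < m.+1 | j != ord_max)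
      (phi0 (dfwith x ord_max w j) : K) =
        \prod_(j < m.+1 | j != ord_max) (phi0 (x j) : K).
      by apply: eq_bigr => j jm; rewrite dfwithout// eq_sym.
    by rewrite !E1.
  rewrite !dfwithout//.
  have E1 w : \prod_(j < m.+1 | j != ord_max) (phi0 (dfwith x i w j) : K) =
      phi0 w * \prod_(j < m.+1 | (j != ord_max) && (j != i)) (phi0 (x j) : K).
    rewrite (bigD1 i)//= dfwithin; congr (_ * _);
      apply: eq_bigr => j /andP[_ ji].
    by rewrite dfwithout// eq_sym.
  rewrite !E1 scalerA mulrA -scalerDl -mulrDl; congr (_ * _ *: _).
  exact: linearP.
move=> x; rewrite prodr_const; congr (_ ^+ _ *: _).
by rewrite (eq_card (B := predC1 ord_max)) ?cardC1 ?card_ord.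
Qed.

Definition weighted_operator : hpoly m.+1 E F :=
  HPoly weighted_operator_subproof.

Lemma rnorm_weighted_operator : rnorm weighted_operator <= rnorm phi0 ^+
  m * rnorm T.
Proof.
apply: hpoly_rnorm_le => x x1 /=; rewrite rnormZ.
apply: ler_pM; rewrite ?rnorm_ge0//; last first.
  by rewrite (le_trans (blin_rnorm _ _))// ler_piMr// rnorm_ge0.
elim: m => [|p IH]; first by rewrite !expr0 -(ofreal1 rT k) rnorm_ofreal normr1.
rewrite !exprS (rnormZ (phi0 x : K) ((phi0 x : K) ^+ p : K^o)).
apply: ler_pM; rewrite ?rnorm_ge0//.
by rewrite (le_trans (blin_rnorm _ _))// ler_piMr// rnorm_ge0.
Qed.

End weighted_operator.

(** * Projections onto classes containing the rank-one polynomials *)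

Section projection.
Variables (rT : realType) (k : scalar_kind).
Local Notation K := (scalar_field rT k).
Variables (E F : completeNormedModType K) (phi : nat -> dual E) (f : nat -> F).
Hypothesis phi_f_cauchy : forall x, unordered_cauchy (fun i => phi i x *: f i).
Hypothesis f_basis : @schauder_basis_of rT k F (closed_span f) f.
Variable d : rT.
Hypotheses (d_gt0 : 0 < d) (f_ge : forall i, d <= rnorm (f i)).

Variables (m : nat) (Z : set (hpoly m.+1 E F)).
Hypothesis Z_rank1 : forall P : hpoly m.+1 E F,
  (exists y, forall x, exists c : K, P x = c *: y) -> Z P.
Hypothesis Z_complemented : complemented Z.

(* The set functions [A |-> r i ((Q A - Pi (Q A)) (x l))], where
   [Q A = phi0 ^ m * T A], vanish on singletons because [Q] of a singleton has
   rank one and is thus fixed by [Pi]. *)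
Lemma projection_agrees (phi0 : dual E) (x : nat -> E) (I : set nat) :
  (forall l, phi0 (x l) = 1 :> K) -> unbounded I ->
  exists (r : nat -> dual F) (C : rT) (M : set nat) (P : hpoly m.+1 E F),
    [/\ forall i y, rnorm (r i y) <= C * rnorm y, M `<=` I, unbounded M, Z P &
        forall i l, M i -> r i (P (x l)) = phi i (x l)].
Proof.
move=> phi0x uI.
have [r [C [rf rC]]] := biorthogonal_functionals f_basis d_gt0 f_ge.
have [T [C' [TP TC]]] := subseries_operators phi_f_cauchy.
have [Pi Pi2 PiZ] := Z_complemented.
pose Q A := weighted_operator m phi0 (T A).
pose G A := Q A - Pi (Q A).
have TU A B : A `&` B = set0 -> T (A `|` B) = T A + T B.
  move=> AB; apply/val_inj/funext => y; apply: (cvg_rnorm_unique (TP _ y)).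
  rewrite (_ : series _ =
    series (fun i => if i \in A then phi i y *: f i else 0)
    \+ series (fun i => if i \in B then phi i y *: f i else 0)).
    by apply: cvgD; exact: TP.
  apply/funext => n; rewrite /series /= -big_split; apply: eq_bigr => i _ /=.
  rewrite in_setU; have [iA|iA] := boolP (i \in A);
    have [iB|iB] /= := boolP (i \in B);
    rewrite ?addr0 ?add0r//.
  by move: iA iB; rewrite !inE => iA iB; have : (A `&` B) i by []; rewrite AB.
have GU A B : A `&` B = set0 -> G (A `|` B) = G A + G B.
  move=> AB; have QU : Q (A `|` B) = Q A + Q B.
    by apply/val_inj/funext => y; rewrite /Q TU//; exact: scalerDr.
  by rewrite /G QU linearD opprD addrACA.
have G1 i : G [set i] = 0.
  have : Z (Q [set i]).
    apply: Z_rank1; exists (f i) => y; exists ((phi0 y : K) ^+ m * phi i y).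
    rewrite -scalerA /=; congr (_ *: _); apply: (cvg_rnorm_unique (TP _ y)).
    apply/cvg_rnormP => e e0; exists i.+1 => n ni.
    rewrite /series /= (bigD1_seq i) ?iota_uniq ?mem_index_iota//= mem_set//.
    rewrite big1 ?addr0 ?subrr ?rnorm0// => j ji.
    by case: ifPn => //; rewrite inE /= => ji'; rewrite ji' eqxx in ji.
  by rewrite -PiZ => -[P _ QP]; rewrite /G -QP Pi2 subrr.
have GC A : rnorm (G A) <= (1 + rnorm Pi) * (rnorm phi0 ^+ m * `|C'|).
  rewrite (le_trans (rnormB _ _))//.
  rewrite (@le_trans _ _ ((1 + rnorm Pi) * rnorm (Q A)))//.
    by rewrite mulrDl mul1r lerD2l blin_rnorm.
  rewrite ler_wpM2l ?addr_ge0 ?rnorm_ge0//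
    (le_trans (rnorm_weighted_operator _ _ _))//.
  rewrite ler_wpM2l ?exprn_ge0 ?rnorm_ge0//.
  apply: blin_rnorm_le => y y1; rewrite (le_trans (TC _ _))//.
  by rewrite (le_trans (ler_wpM2r (rnorm_ge0 _) (ler_norm _)))// ler_piMr.
(* The Boolean switches between Re a and Re(ia), which together determine the scalar a; the triples
   remain countable. *)
pose Lam (j : nat * nat * bool) A :=
  realpart ((if j.2 then imunit k else 1) * r j.1.1 (G A (x j.1.2)) : K).
have [|||M [MI uM LM]] := almost_disjoint_null_set (Lam := Lam) uI.
- move=> j A B AB; rewrite /Lam GU// hpolyD -realpartD -mulrDr;
  congr (realpart (_ * _)).
  exact: linearD.
- by move=> j i; rewrite /Lam G1 [r _ _]linear0 mulr0 realpart0.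
- move=> [[i l] b].
  exists (rnorm ((if b then imunit k else 1) : K^o) *
    (`|C| * ((1 + rnorm Pi) * (rnorm phi0 ^+ m * `|C'|) * rnorm (x l) ^+ m.+1)))
    => A.
  rewrite /Lam /= (le_trans (norm_realpart_le _))//.
  rewrite (rnormZ (if b then imunit k else 1) (r i (G A (x l)) : K^o)).
  rewrite ler_wpM2l ?rnorm_ge0// (le_trans (rC _ _))//.
  rewrite (le_trans (ler_wpM2r (rnorm_ge0 _) (ler_norm C)))// ler_wpM2l//.
  by rewrite (le_trans (hpoly_rnorm _ _))// ler_wpM2r ?exprn_ge0 ?rnorm_ge0.
exists r, C, M, (Pi (Q M)); split => //; first by rewrite -PiZ; exists (Q M).
move=> i l Mi.
have rG : r i (G M (x l)) = 0 :> K.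
  rewrite (scalarE (r i (G M (x l)) : K)); have := LM (i, l, false);
    have := LM (i, l, true).
  by rewrite /Lam /= mul1r => -> ->; rewrite ofreal0 mulr0 subr0.
have -> : r i (Pi (Q M) (x l)) = r i (Q M (x l)).
  apply/esym/eqP; rewrite -subr_eq0; apply/eqP.
  by rewrite -linearB; exact: rG.
(* On the hyperplane [Q M] coincides with [T M], and [r i] extracts the i-th term of its series,
   present because [i] is in [M]. *)
rewrite /= phi0x expr1n scale1r.
have rlip v w : rnorm (r i v - r i w) <= C * rnorm (v - w) by rewrite -linearB
  rC.
have rl := cvg_rnorm_linear rlip (TP M (x l)).
apply: (cvg_rnorm_unique rl); apply/cvg_rnormP => e e0; exists i.+1 => n ni /=.
rewrite /series /= linear_sum (bigD1_seq i) ?iota_uniq ?mem_index_iota//=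
  mem_set//.
rewrite [r i (_ *: _)]linearZ /= rf eqxx.
rewrite big1 => [|j /negbTE ji]; last first.
  case: ifP => _; last exact: linear0.
  by rewrite [r i _]linearZ /= rf eq_sym ji; exact: scaler0.
by rewrite addr0 (_ : _ *: _ = phi i (x l)) ?subrr ?rnorm0//; exact: mulr1.
Qed.

End projection.

(** * Compactness and weak compactness *)

(** A filter on this set that does not cluster at [l] misses a neighbourhood of [l], hence lives on
    finitely many terms. *)
Lemma compact_cvg_range (T : topologicalType) (u : nat -> T) (l : T) :
  u @ \oo --> l -> compact (l |` range u).
Proof.
move=> ul F FF FU.
have [cl|ncl] := pselect (cluster F l); first by exists l; split=> //; left.
have [A [B [FA Bl AB]]] : exists A B, [/\ F A, nbhs l B & A `&` B = set0].
  apply: contrapT => H; apply: ncl => A B FA Bl; apply/set0P/eqP => AB.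
  by apply: H; exists A, B.
have [N _ NB] := ul _ Bl.
have /finite_compact : finite_set (u @` `I_N) by exact/finite_image/finite_II.
move=> /(_ F FF)[|y [[i _ <-] cy]]; last by exists (u i); split=> //; right;
  exists i.
apply: filterS (filterI FA FU) => y [Ay [ly|[i _ iy]]].
  suff : (A `&` B) y by rewrite AB.
  by split=> //; rewrite ly; exact: nbhs_singleton.
exists i => //=; rewrite ltnNge; apply/negP => Ni.
suff : (A `&` B) y by rewrite AB.
by split=> //; rewrite -iy; exact: NB.
Qed.

Section weak_topology.
Variables (rT : realType) (k : scalar_kind).
Local Notation K := (scalar_field rT k).
Variable E : normedModType K.

Lemma weak_eval_continuous (psi : dual E) :
  continuous ((fun x => psi x) : @weak rT k E -> K^o).
Proof.
pose ev := (fun x phi => phi x) : E -> {ptws dual E -> K^o}.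
move=> x; apply: (@continuous_comp (@weak rT k E) {ptws dual E -> K^o} K^o ev
  (fun h => h psi)); first exact: initial_continuous.
exact: (@proj_continuous _ (fun _ : dual E => K^o) psi).
Qed.

Lemma weak_cvgP (G : set_system E) (x : E) : Filter G ->
  G --> (x : @weak rT k E) <->
  forall psi : dual E, psi @ G --> (psi x : K^o).
Proof.
move=> FG; split=> [Gx psi|H].
  exact: (@cvg_comp _ (@weak rT k E) K^o id (fun y => psi y) _ _ _ Gx
    (@weak_eval_continuous psi x)).
pose ev := (fun x phi => phi x) : E -> {ptws dual E -> K^o}.
move=> A /= [_ [[B Bop <-] Bx] BA].
have FevG : Filter (ev @ G) by exact: fmap_filter.
have : ev @ G --> (ev x : {ptws dual E -> K^o}).
  have [_ +] := @pointwise_cvgP (dual E) K^o (ev @ G) (ev x) FevG; apply => psi;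
    exact: H.
have xB : nbhs (ev x) B by exact: open_nbhs_nbhs.
by move=> /(_ _ xB) GB; exact: (filterS BA GB).
Qed.

(** Hahn-Banach separates points. The lemma makes weakly compact sets weakly closed, as the closed
    superset in [precompact] demands. *)
Lemma weak_hausdorff : hausdorff_space (@weak rT k E).
Proof.
move=> x y xy; apply/eqP; rewrite -subr_eq0; apply: contrapT => /negP xy0.
have [||psi [_ _ pd]] := @separating_functional _ _ E [set 0] (x - y)
  (rnorm (x - y : E)).
- by split=> //= [_ _ -> ->|a _ ->]; [exact: addr0|exact: scaler0].
- by move=> _ ->; rewrite subr0.
have e0 : 0 < rnorm (x - y : E) by rewrite rnorm_gt0.
pose d := rnorm (psi x - psi y).
have d0 : 0 < d / 2 by rewrite divr_gt0// /d -linearB (lt_le_trans e0).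
have nb (z : E) : @nbhs _ (@weak rT k E) z
  [set w | rnorm (psi w - psi z : K^o) < d / 2].
  have nz : nbhs (psi z : K^o) [set c : K^o | rnorm (c - psi z : K^o) < d / 2].
    by apply/nbhs_rnormP; exists (d / 2).
  exact: (@weak_eval_continuous psi z _ nz).
have [z [/= zx zy]] := xy _ _ (nb x) (nb y).
have := rdistD (psi z) (psi x) (psi y); rewrite -/d (rdistC (psi x)).
by have := zx; have := zy; lra.
Qed.

Lemma precompact_weakly_precompact (A : set E) :
  precompact A -> @weakly_precompact rT k E A.
Proof.
move=> [U AU [cU _]].
have wU : @compact (@weak rT k E) U.
  rewrite -[U]image_id; apply: (@continuous_compact E (@weak rT k E) id) => //.
  apply: continuous_subspaceT => x; apply/weak_cvgP => psi.
  exact: blin_continuous.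
by exists U => //; split=> //; exact: compact_closed weak_hausdorff wU.
Qed.

Lemma precompact_cluster (A : set E) (u : nat -> E) :
  precompact A -> (forall n, A (u n)) -> exists y, forall (e : rT) N, 0 < e ->
    exists2 m, (N <= m)%N & rnorm (u m - y) < e.
Proof.
move=> [U AU [cU _]] Au.
have [|y [_ cy]] := cU (u @ \oo) _; first by exists 0%N => // n _; exact: AU.
exists y => e N e0.
have [||z [[m /= Nm <-] my]] :=
  cy (u @` [set m | (N <= m)%N]) [set w | rnorm (w - y) < e].
- by exists N => // m /= Nm; exists m.
- by apply/nbhs_rnormP; exists e.
by exists m.
Qed.

Lemma weakly_precompact_cluster (A : set E) (u : nat -> E) :
  @weakly_precompact rT k E A -> (forall n, A (u n)) ->
  exists y, forall (psi : dual E) (e : rT) N, 0 < e ->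
    exists2 m, (N <= m)%N & rnorm (psi (u m) - psi y) < e.
Proof.
move=> [U AU [cU _]] Au.
have [|y [_ cy]] := cU (u @ \oo) _; first by exists 0%N => // n _; exact: AU.
exists y => psi e N e0.
have [||z [[m /= Nm <-] my]] := cy (u @` [set m | (N <= m)%N])
    [set w | rnorm (psi w - psi y) < e].
- by exists N => // m /= Nm; exists m.
- have ny : nbhs (psi y : K^o) [set c : K^o | rnorm (c - psi y : K^o) < e].
    by apply/nbhs_rnormP; exists e.
  exact: (@weak_eval_continuous psi y _ ny).
by exists m.
Qed.

Lemma cvg_precompact_range (u : nat -> E) (l : E) : u @ \oo --> l ->
  precompact (range u).
Proof.
move=> /compact_cvg_range cU; exists (l |` range u); first by move=> x; right.
by split=> //; apply: compact_closed cU; exact: norm_hausdorff.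
Qed.

Lemma weak_cvg_weakly_precompact_range (u : nat -> E) (l : E) :
  (forall psi : dual E, psi \o u @ \oo --> (psi l : K^o)) ->
  @weakly_precompact rT k E (range u).
Proof.
move=> H; have /(@compact_cvg_range (@weak rT k E)) cU :
    u @ \oo --> (l : @weak rT k E) by apply/weak_cvgP.
exists (l |` range u); first by move=> x; right.
by split=> //; apply: compact_closed cU; exact: weak_hausdorff.
Qed.

Lemma bounded_setP (B : set E) :
  bounded_set B <-> exists b : rT, forall x, B x -> rnorm x <= b.
Proof.
split=> [[M [Mr H]]|[b bP]].
  have : realpart `|M| + 1 > realpart `|M| by rewrite ltrDl.
  rewrite -(ltr_ofreal k) -ger0_ofreal// => M1.
  exists (realpart `|M| + 1) => x Bx; rewrite -(ler_ofreal k) -rnormE.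
  by apply: H => //; apply: le_lt_trans M1; exact: real_ler_norm.
exists (ofreal k b); split.
  have [b0|/ltW b0] := leP 0 b.
    by apply: ger0_real; rewrite -(ofreal0 rT k) ler_ofreal.
  by apply: ler0_real; rewrite -(ofreal0 rT k) ler_ofreal.
by move=> M bM x Bx; rewrite /= (le_trans _ (ltW bM))// rnormE ler_ofreal bP.
Qed.

(** The set lies in the image of a compact real square under the coordinates of [scalarE], for both
    scalar fields at once. *)
Lemma precompact_line (y : E) (B : set E) :
  (forall z, B z -> exists c : K, z = c *: y) ->
  bounded_set B -> precompact B.
Proof.
move=> By /bounded_setP[b bP].
have [y0|y0] := eqVneq y 0.
  apply: (precompact_subset (B := range (fun _ : nat => 0 : E))).
    by move=> z /By[c ->]; exists 0%N => //; rewrite y0 scaler0.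
  exact: (cvg_precompact_range (cvg_cst 0)).
have ny0 : 0 < rnorm y by rewrite rnorm_gt0.
(* As |c| <= b/|y|, this dominates both Re c and Re(ic). *)
pose r := (1 + rnorm (imunit k : K^o)) * (b / rnorm y).
pose I : set rT := [set` `[- r, r]].
pose h (p : rT * rT) : E := ofreal k p.1 *: y - ofreal k p.2 *: (imunit k *: y).
have hc : continuous h.
  have sc (z : E) : continuous (fun t : rT => ofreal k t *: z).
    move=> t A /nbhs_rnormP[e e0 eA]; apply/nbhs_ballP.
    have z0 : 0 < rnorm z + 1 by rewrite ltr_wpDl ?rnorm_ge0.
    exists (e / (rnorm z + 1)); first by rewrite /= divr_gt0.
    move=> s /=; rewrite /ball /= distrC ltr_pdivlMr// => st; apply: eA.
    rewrite -scalerBl -ofrealN -ofrealD rnormZr (le_lt_trans _ st)//.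
    by rewrite ler_wpM2l// lerDl.
  move=> p; apply: cvgB.
    by apply: (@continuous_comp _ _ _ (@fst rT rT) (fun t => ofreal k t *: y)
      p);
      [exact: cvg_fst|exact: sc].
  by apply: (@continuous_comp _ _ _ (@snd rT rT)
    (fun t => ofreal k t *: (imunit k *: y)) p); [exact: cvg_snd|exact: sc].
have cU : compact (h @` (I `*` I)).
  apply: continuous_compact; first exact: continuous_subspaceT.
  by apply: compact_setX; exact: segment_compact.
exists (h @` (I `*` I)); last by split=> //;
  exact: compact_closed (@norm_hausdorff _ _) cU.
move=> z Bz; have [c zc] := By _ Bz; have := bP _ Bz;
  rewrite zc rnormZ -ler_pdivlMr// => cr.
have c0 := rnorm_ge0 (c : K^o); have i0 := rnorm_ge0 (imunit k : K^o).
have ir : rnorm (imunit k : K^o) * rnorm (c : K^o) <=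
  rnorm (imunit k : K^o) * (b / rnorm y).
  by rewrite ler_wpM2l.
have Ir (a : K) : rnorm (a : K^o) <= r -> I (realpart a).
  by move=> ar; rewrite /I /= in_itv /=
    -ler_norml (le_trans (norm_realpart_le _)).
exists (realpart c, realpart (imunit k * c)).
  split; apply: Ir; rewrite /r mulrDl mul1r /=; first by nra.
  by rewrite (rnormZ (imunit k) (c : K^o)); nra.
by rewrite /h /= scalerA -scalerBl [ofreal k _ * imunit k]mulrC -scalarE.
Qed.

End weak_topology.

(** * Helly's theorem *)

Section helly.
Variables (rT : realType) (k : scalar_kind).
Local Notation K := (scalar_field rT k).
Variables (E : normedModType K) (phi : nat -> dual E).

(** Such a [psi] is a linear combination of the first [n] functionals, on which evaluation at [x]
    and [Phi] agree; the induction avoids naming coefficients. *)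
Lemma functional_on_kernel (Phi : dual (dual E)) (psi : dual E) n x :
  (forall z, (forall i, (i < n)%N -> phi i z = 0 :> K) -> psi z = 0 :> K) ->
  (forall i, (i < n)%N -> phi i x = Phi (phi i) :> K) -> psi x = Phi psi :> K.
Proof.
elim: n psi => [|n IH] psi ker xP.
  have -> : psi = 0 by apply/val_inj/funext => z; exact: ker.
  by rewrite blin0 linear0.
have [sub|nsub] := pselect (forall z,
  (forall i, (i < n)%N -> phi i z = 0 :> K) -> phi n z = 0 :> K).
  apply: IH => [z zP|i /ltnW]; last exact: xP.
  by apply: ker => i; rewrite ltnS leq_eqVlt => /predU1P[->|/zP//]; exact: sub.
have [z [zP zn]] : exists z, (forall i, (i < n)%N -> phi i z = 0 :> K) /\
  phi n z = 1 :> K.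
  apply: contrapT => H; apply: nsub => z zP; apply: contrapT => /eqP pn;
    apply: H.
  exists ((phi n z)^-1 *: z); split; last by rewrite [phi n (_ *: z)]linearZ;
    exact: mulVf.
  by move=> i /zP e; rewrite [phi i (_ *: z)]linearZ /= e; exact: mulr0.
(* Since psi'(w) = psi(w - phi_n(w) z), and w - phi_n(w) z is killed by [phi n] too, [psi'] vanishes
   on the common kernel of the first [n] functionals. *)
pose psi' : dual E := psi - (psi z : K) *: phi n.
have psi'E w : psi' w = (psi w : K) - (psi z : K) * phi n w by [].
have psi'0 w : (forall i, (i < n)%N -> phi i w = 0 :> K) -> psi' w = 0 :> K.
  move=> wP; have pE (p : dual E) : p (w - (phi n w : K) *: z) =
    (p w : K) - phi n w * p z :> K.
    by rewrite [p (_ - _)]linearB /= [p (_ *: z)]linearZ.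
  rewrite psi'E [X in _ - X]mulrC -pE; apply: ker => i;
    rewrite ltnS leq_eqVlt pE.
  by move=> /predU1P[->|iN];
    [rewrite zn mulr1 subrr|rewrite wP// zP// mulr0 subrr].
have := IH psi' psi'0 (fun i h => xP i (ltnW h)).
have -> : Phi psi' = (Phi psi : K) - (psi z : K) * Phi (phi n).
  by rewrite [Phi psi']linearB /= [Phi (_ *: _)]linearZ.
by rewrite psi'E (xP n)// => /addIr.
Qed.

Lemma functionals_interpolation (Phi : dual (dual E)) n :
  exists x, forall i, (i < n)%N -> phi i x = Phi (phi i) :> K.
Proof.
elim: n => [|n [x xP]]; first by exists 0.
have [sub|nsub] := pselect (forall z,
  (forall i, (i < n)%N -> phi i z = 0 :> K) -> phi n z = 0 :> K).
  exists x => i; rewrite ltnS leq_eqVlt => /predU1P[->|/xP//].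
  exact: functional_on_kernel sub xP.
have [z [zP zn]] : exists z, (forall i, (i < n)%N -> phi i z = 0 :> K) /\
  phi n z != 0 :> K.
  apply: contrapT => H; apply: nsub => z zP; apply: contrapT => /eqP pn;
    apply: H.
  by exists z.
have pE (p : dual E) (a : K) : p (x + a *: z) = (p x : K) + a * p z :> K.
  by rewrite [p (_ + _)]linearD /= [p (_ *: z)]linearZ.
exists (x + ((Phi (phi n) - phi n x : K) / phi n z) *: z) => i.
rewrite pE ltnS leq_eqVlt => /predU1P[->|iN];
  last by rewrite (zP i iN) mulr0 addr0 xP.
by rewrite divfK// addrC subrK.
Qed.

(** Correct any solution [x] by the common kernel. If no correction is short enough, a separating
    psi of norm at most 1 has |psi(x)| >= |Phi| + 1, whereas psi(x) = Phi(psi). *)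
Lemma helly (Phi : dual (dual E)) n : exists2 x, rnorm x <= rnorm Phi + 1 &
  forall i, (i < n)%N -> phi i x = Phi (phi i) :> K.
Proof.
have [x xP] := functionals_interpolation Phi n.
pose M := [set z | forall i, (i < n)%N -> phi i z = 0 :> K].
have sM : subspace M.
  split=> [i _|v w Mv Mw i ni|a v Mv i ni]; first exact: linear0.
    by rewrite [phi i (v + w)]linearD /= (Mv i ni) (Mw i ni) addr0.
  by rewrite [phi i (a *: v)]linearZ /= (Mv i ni); exact: mulr0.
apply: contrapT => H.
have [|psi [psi1 psi0 psix]] := @separating_functional _ _ _ M x (rnorm Phi + 1)
  sM.
  move=> z Mz; rewrite leNgt; apply/negP => xz; apply: H.
  by exists (x - z) => [|i ni];
    rewrite ?(ltW xz)// [phi i (x - z)]linearB /= (Mz i ni) subr0 xP.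
have psiE : psi x = Phi psi :> K by apply: functional_on_kernel xP => z;
  exact: psi0.
have : rnorm psi <= 1 by apply: blin_rnorm_le => z /(le_trans (psi1 z)).
have := blin_rnorm Phi psi; rewrite -psiE; have := rnorm_ge0 Phi.
move: psix; nra.
Qed.

End helly.

(** * Non-complementation *)

Section noncomplemented.
Variables (rT : realType) (k : scalar_kind).
Local Notation K := (scalar_field rT k).
Variables (E F : completeNormedModType K) (phi : nat -> dual E) (f : nat -> F).
Hypothesis phi_f_cauchy : forall x, unordered_cauchy (fun i => phi i x *: f i).
Hypothesis f_basis : @schauder_basis_of rT k F (closed_span f) f.
Variable d : rT.
Hypotheses (d_gt0 : 0 < d) (f_ge : forall i, d <= rnorm (f i)).

(** The Cauchy criterion on singletons, with the norms of the [f i] bounded below by [d]. *)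
Lemma pointwise_null x (e : rT) : 0 < e ->
  exists N, forall i, (N <= i)%N -> rnorm (phi i x) < e.
Proof.
move=> e0; have ed0 : 0 < e * d by rewrite mulr_gt0.
have [N NP] := phi_f_cauchy x ed0; exists N => i Ni.
have := NP [:: i]; rewrite big_seq1 rnormZ => /(_ isT) H.
rewrite -(ltr_pM2r d_gt0); apply: le_lt_trans (H _).
  by rewrite ler_wpM2l ?rnorm_ge0.
by move=> j; rewrite inE => /eqP ->.
Qed.

(* Moving [x] to the hyperplane [phi0 = 1], where [phi0 ^ m * T] restricts to
   [T], changes [phi i x] by a null sequence. *)
Lemma normalization i0 (b e : rT) : phi i0 <> 0 -> 0 < e ->
  exists (phi0 : dual E) (h : E -> E) (b' : rT) N, forall x, rnorm x <= b ->
    [/\ phi0 (h x) = 1 :> K, rnorm (h x) <= b' &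
      forall i, (N <= i)%N -> rnorm (phi i x) - e <= rnorm (phi i (h x))].
Proof.
move=> phi_neq0 e0; have [z0 pz0] : exists z0, phi i0 z0 != 0 :> K.
  apply: contrapT => H; apply: phi_neq0; apply/val_inj/funext => z /=.
  by apply: contrapT => /eqP pz; apply: H; exists z.
pose p0 := phi i0; pose z := (p0 z0 : K)^-1 *: z0.
have pz : p0 z = 1 :> K by rewrite [LHS]linearZ; exact: mulVf.
pose h x := x + (1 - p0 x : K) *: z.
have hE (p : dual E) x : p (h x) = (p x : K) + (1 - p0 x : K) * p z :> K.
  by rewrite [LHS]linearD /= [p (_ *: z)]linearZ.
(* This bounds the coefficient of [z] in [h x] for |x| <= b, so |phi_i(z)| < e/c keeps the
   perturbation below e. *)
pose c := 1 + rnorm p0 * `|b|.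
have c0 : 0 < c by rewrite ltr_pwDl// mulr_ge0 ?rnorm_ge0.
have xc x : rnorm x <= b -> rnorm (1 - p0 x : K^o) <= c.
  move=> xb; rewrite (le_trans (rnormB _ _))//
    -(ofreal1 rT k) rnorm_ofreal normr1 lerD2l.
  rewrite (le_trans (blin_rnorm _ _))// ler_wpM2l ?rnorm_ge0// (le_trans xb)//.
  exact: ler_norm.
have [N NP] := pointwise_null z (divr_gt0 e0 c0).
exists p0, h, (b + c * rnorm z), N => x xb; split.
- by rewrite hE pz mulr1 addrC subrK.
- by rewrite /h (le_trans (rnormD _ _))// lerD// rnormZ ler_wpM2r ?rnorm_ge0//
  xc.
- move=> i Ni; rewrite hE lerBlDr.
  have := rnormB ((phi i x : K) + (1 - p0 x : K) * phi i z : K^o)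
    ((1 - p0 x : K) * phi i z : K^o).
  rewrite addrK => /le_trans; apply; rewrite lerD2l.
  rewrite (rnormZ (1 - p0 x : K) (phi i z))
    (le_trans (ler_wpM2r (rnorm_ge0 _) (xc _ xb)))//.
  by have := NP i Ni; rewrite ltr_pdivlMr// mulrC => /ltW.
Qed.

Variable m : nat.

Lemma compact_polys_rank1 (P : hpoly m.+1 E F) :
  (exists y, forall x, exists c : K, P x = c *: y) -> compact_polys P.
Proof.
move=> [y Py] B /bounded_setP[b bB]; apply: (precompact_line (y := y)).
  by move=> _ [x _ <-]; exact: Py.
apply/bounded_setP; exists (rnorm P * `|b| ^+ m.+1) => _ [x Bx <-].
rewrite (le_trans (hpoly_rnorm _ _))// ler_wpM2l ?rnorm_ge0//.
by rewrite lerXn2r// ?nnegrE ?rnorm_ge0// (le_trans (bB _ Bx))// ler_norm.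
Qed.

Lemma compact_polys_not_complemented : ~ precompact (range phi) ->
  ~ complemented (@compact_polys rT k m.+1 E F).
Proof.
move=> ncp cZ.
(* A norm null sequence has precompact range, so [phi] is not norm null. *)
have [e e0 ue] : exists2 e : rT, 0 < e & unbounded [set i | e <= rnorm (phi i)].
  apply: unbounded_lb => H; apply: ncp; apply: (cvg_precompact_range (l := 0)).
  by apply/cvg_rnormP => e /H[N NP]; exists N => i /NP; rewrite subr0.
have [i0 _ phi_i0] := ue 0%N.
have phi_neq0 : phi i0 <> 0.
  by move=> p0; move: phi_i0; rewrite /= p0 rnorm0 leNgt e0.
have /choice [x xP] i : exists z, rnorm z <= 1 /\
    (e <= rnorm (phi i) -> e / 2 <= rnorm (phi i z)).
  have [ei|nei] := pselect (e <= rnorm (phi i)); last first.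
    by exists 0; rewrite rnorm0.
  apply: contrapT => H; have : rnorm (phi i) <= e / 2; last by move: ei e0; lra.
  apply: blin_rnorm_le => z z1; rewrite leNgt; apply/negP => ez; apply: H.
  by exists z; split=> // _; exact: ltW.
(* The points reach e/2 and the normalization costs at most e/4, so e/4 remains. *)
have e40 : 0 < e / 4 by lra.
have [phi0 [h [b [N hP]]]] := normalization 1 phi_neq0 e40.
have phi0h i : phi0 (h (x i)) = 1 :> K by have [] := hP _ (xP i).1.
have [r [C [M [P [rC MI uM ZP rP]]]]] :=
  projection_agrees phi_f_cauchy f_basis d_gt0 f_ge compact_polys_rank1 cZ phi0h
    (unbounded_ge N ue).
have phi_ge i : M i -> e / 4 <= rnorm (phi i (h (x i))).
  move=> /MI[/= ei Ni]; have [_ _ /(_ _ Ni)] := hP _ (xP i).1.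
  by have := (xP i).2 ei; lra.
have /choice [mu muP] n : exists i, (n <= i)%N /\ M i.
  by have [i ni Mi] := uM n; exists i.
have cB : precompact (P @` range (h \o x)).
  apply: ZP; apply/bounded_setP; exists b => _ [i _ <-].
  by have [] := hP _ (xP i).1.
have [y yP] := precompact_cluster cB (u := fun n => P (h (x (mu n))))
  ltac:(by move=> n; exists (h (x (mu n))) => //; exists (mu n)).
(* Values of [P] within [eta] of the cluster point have images under [r i] at most 2 eta (|C| + 1) =
   e/8 apart, less than the gap e/4 - e/16 obtained below. *)
pose eta := e / 4 / (4 * (`|C| + 1)).
have C0 : 0 < `|C| + 1 by rewrite ltr_wpDl.
have eta0 : 0 < eta by rewrite divr_gt0// mulr_gt0.
have [n0 _ yn0] := yP eta 0%N eta0.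
have e160 : 0 < e / 16 by lra.
(* With the point of index [mu n0] fixed, the second index [mu n] is taken so far out that
   [phi (mu n)] is small at that point, though not at its own. *)
have [N1 N1P] := pointwise_null (h (x (mu n0))) e160.
have [n N1n yn] := yP eta N1 eta0.
have [nmu Mmu] := muP n.
have := N1P (mu n) (leq_trans N1n nmu); rewrite -(rP _ _ Mmu).
have := phi_ge _ Mmu; rewrite -(rP _ _ Mmu).
set u := P _ in yn *; set v := P _ in yn0 *; move=> ru rv.
have := rC (mu n) (u - v); rewrite [r _ (u - v)]linearB.
have uv : rnorm (u - v) <= 2 * eta.
  by have := rdistD y u v; rewrite (rdistC y v); move: yn yn0; lra.
have : C * rnorm (u - v) <= (`|C| + 1) * (2 * eta).
  rewrite (le_trans (ler_wpM2r (rnorm_ge0 _) (ler_norm C)))//.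
  by rewrite ler_pM ?rnorm_ge0// lerDl.
have -> : (`|C| + 1) * (2 * eta) = e / 8.
  by rewrite /eta; field; rewrite gt_eqF.
have := rdistD (r (mu n) v) (r (mu n) u) 0; rewrite !subr0.
move: ru rv; lra.
Qed.

Lemma weakly_compact_polys_not_complemented :
  ~ @weakly_precompact rT k (dual E) (range phi) ->
  ~ complemented (@weakly_compact_polys rT k m.+1 E F).
Proof.
move=> ncp cZ.
(* A weakly null sequence has weakly precompact range, so some [Phi] does not tend to 0 along
   [phi]. *)
have [Phi [e e0 ue]] : exists Phi : dual (dual E), exists2 e : rT, 0 < e &
    unbounded [set i | e <= rnorm (Phi (phi i))].
  apply: contrapT => H; apply: ncp;
    apply: (weak_cvg_weakly_precompact_range (l := 0)).
  move=> Phi; apply/cvg_rnormP; rewrite linear0; apply: contrapT => nH.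
  apply: H; exists Phi; apply: unbounded_lb => H; apply: nH => e /H[N NP].
  by exists N => i /NP; rewrite subr0.
have [i0 _ phi_i0] := ue 0%N.
have phi_neq0 : phi i0 <> 0.
  by move=> p0; move: phi_i0; rewrite /= p0 linear0 rnorm0 leNgt e0.
(* The bound [l.+1] includes the index [l] itself, as [r_ge] requires. *)
have /choice [x xP] l : exists z, rnorm z <= rnorm Phi + 1 /\
    forall i, (i < l.+1)%N -> phi i z = Phi (phi i) :> K.
  by have [x x1 xP] := helly phi Phi l.+1; exists x.
have e20 : 0 < e / 2 by lra.
have [phi0 [h [b [N hP]]]] := normalization (rnorm Phi + 1) phi_neq0 e20.
have phi0h l : phi0 (h (x l)) = 1 :> K by have [] := hP _ (xP l).1.
have Z1 (P : hpoly m.+1 E F) : (exists y, forall x, exists c : K, P x = c *: y)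
  ->
    weakly_compact_polys P.
  by move=> /compact_polys_rank1 cP B /cP; exact: precompact_weakly_precompact.
have [r [C [M [P [rC MI uM ZP rP]]]]] :=
  projection_agrees phi_f_cauchy f_basis d_gt0 f_ge Z1 cZ phi0h
    (unbounded_ge N ue).
pose u l := P (h (x l)).
have r_ge i l : M i -> (i <= l)%N -> e / 2 <= rnorm (r i (u l)).
  move=> Mi il; rewrite (rP _ _ Mi); have [/= ei Ni] := MI _ Mi.
  by have [_ _ /(_ _ Ni)] := hP _ (xP l).1; rewrite (xP l).2//; move: ei; lra.
have cB : @weakly_precompact rT k F (P @` range (h \o x)).
  apply: ZP; apply/bounded_setP; exists b => _ [i _ <-].
  by have [] := hP _ (xP i).1.
have [y yP] := weakly_precompact_cluster cB (u := u)
  ltac:(by move=> n; exists (h (x n)) => //; exists n).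
have ry i : M i -> e / 4 <= rnorm (r i y).
  move=> Mi; have e40 : 0 < e / 4 by lra.
  have [l il] := yP (r i) _ i e40; have := r_ge _ _ Mi il.
  have := rdistD (r i y) (r i (u l)) 0; rewrite !subr0; lra.
(* The vectors on which [r i] tends to 0 along [M]; each [u l] belongs to it by [pointwise_null]. *)
pose W := [set z : F | forall e : rT, 0 < e ->
  exists N, forall i, (N <= i)%N -> M i -> rnorm (r i z) < e].
have sW : subspace W.
  split.
  - by move=> e' e'0; exists 0%N => i _ _; rewrite linear0 rnorm0.
  - move=> v w Wv Ww e' e'0; have e2 : 0 < e' / 2 by lra.
    have [N1 N1P] := Wv _ e2; have [N2 N2P] := Ww _ e2;
      exists (maxn N1 N2) => i.
    rewrite geq_max => /andP[/N1P h1 /N2P h2] Mi; rewrite linearD.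
    by rewrite (le_lt_trans (rnormD _ _))// (splitr e') ltrD ?h1 ?h2.
  - move=> a v Wv e' e'0;
    have a0 : 0 < rnorm (a : K^o) + 1 by rewrite ltr_wpDl ?rnorm_ge0.
    have [N1 N1P] := Wv _ (divr_gt0 e'0 a0); exists N1 => i /N1P h1 /h1.
    rewrite linearZ rnormZ ltr_pdivlMr// mulrC; apply: le_lt_trans.
    by rewrite ler_wpM2r ?rnorm_ge0// lerDl.
have Wu l : W (u l).
  move=> e' e'0; have [N1 N1P] := pointwise_null (h (x l)) e'0.
  by exists N1 => i Ni Mi; rewrite (rP _ _ Mi) N1P.
(* Otherwise a functional vanishing on [W], hence on every [u l], would be bounded away from 0 at
   [y], against weak clustering. The tolerance makes |r_i(y - z)| at most e/8, so [ry] fails for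
   large [i] in [M]. *)
have [z Wz yz] : exists2 z, W z & rnorm (y - z) < e / 8 / (`|C| + 1).
  apply: contrapT => H.
  have eta0 : 0 < e / 8 / (`|C| + 1) by rewrite !divr_gt0// ltr_wpDl.
  have [|psi [_ psi0 psiy]] := @separating_functional _ _ F W y
    (e / 8 / (`|C| + 1)) sW.
    by move=> z Wz; rewrite leNgt; apply/negP => yz; apply: H; exists z.
  have [l _] := yP psi _ 0%N eta0; rewrite psi0// sub0r rnormN.
  by rewrite ltNge psiy.
have e80 : 0 < e / 8 by lra.
have [N1 N1P] := Wz _ e80; have [i Ni Mi] := uM N1.
have C0 : 0 < `|C| + 1 by rewrite ltr_wpDl.
have := rC i (y - z); rewrite [r i (y - z)]linearB.
have : C * rnorm (y - z) <= e / 8.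
  rewrite (le_trans (ler_wpM2r (rnorm_ge0 _) (ler_norm C)))//.
  rewrite ltr_pdivlMr// mulrC in yz; rewrite (le_trans _ (ltW yz))//.
  by rewrite ler_wpM2r ?rnorm_ge0// lerDl.
have := N1P _ Ni Mi; have := ry _ Mi.
have := rdistD (r i z) (r i y) 0; rewrite !subr0; lra.
Qed.

End noncomplemented.

Theorem theorem3p2 (rT : realType) (k : scalar_kind)
    (E F G : completeNormedModType (scalar_field rT k))
    (g : nat -> G) (g' : nat -> dual G)
    (g_basis : unconditional_basis g)
    (g'_coord : coordinate_functionals g g') :
  ((exists (R : blin G F) (S : blin E G),
       seminormalized_basic_sequence (R \o g) /\
       ~ precompact [set adjoint S (g' i) | i in setT]) ->
   forall n : nat, (0 < n)%N ->
     ~ complemented (@compact_polys rT k n E F)) /\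
  ((exists (R : blin G F) (S : blin E G),
       seminormalized_basic_sequence (R \o g) /\
       ~ weakly_precompact [set adjoint S (g' i) | i in setT]) ->
   forall n : nat, (0 < n)%N ->
     ~ complemented (@weakly_compact_polys rT k n E F)).
Proof.
(* Unconditionality of [g] gives the criterion in [G] for the expansion of [S x], and the bounded
   operator [R] carries it to [F]. *)
have cauchy (R : blin G F) (S : blin E G) x :
    unordered_cauchy (fun i => adjoint S (g' i) x *: (R \o g) i).
  have uG : unordered_cauchy (fun i => g' i (S x) *: g i).
    apply: permuted_series_unordered_cauchy => s sbij.
    apply: (g_basis.2 (fun i => g' i (S x))) => //.
    by apply/cvg_ex; exists (S x); exact: g'_coord.
  move=> e e0; have R0 : 0 < rnorm R + 1 by rewrite ltr_wpDl ?rnorm_ge0.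
  have [n nP] := uG _ (divr_gt0 e0 R0); exists n => s us sn.
  have := nP s us sn; rewrite ltr_pdivlMr// mulrC; apply: le_lt_trans.
  rewrite (_ : \sum_(i <- s) _ = R (\sum_(i <- s) g' i (S x) *: g i));
    last first.
    by rewrite linear_sum; apply: eq_bigr => i _; rewrite linearZ.
  by rewrite (le_trans (blin_rnorm _ _))// ler_wpM2r ?rnorm_ge0// lerDl.
have lower (R : blin G F) : seminormalized_basic_sequence (R \o g) ->
    exists2 d : rT, 0 < d & forall i, d <= rnorm ((R \o g) i).
  move=> [_ [a [b [a0 ab]]]]; exists (realpart a).
    by rewrite -(ltr_ofreal k) ofreal0 -ger0_ofreal ?ltW.
  move=> i; have /andP[/ltW ai _] := ab i.
  by rewrite -(ler_ofreal k) -(ger0_ofreal (ltW a0)) -rnormE.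
split=> -[R [S [Rg nc]]] [//|m] _; have [d d0 dR] := lower R Rg.
- exact: (compact_polys_not_complemented (cauchy R S) Rg.1 d0 dR nc).
- exact: (weakly_compact_polys_not_complemented (cauchy R S) Rg.1 d0 dR nc).
Qed.
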